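(* Over binary schemas, $(\mathcal{ALCU},\mathrm{AQ})$ and $(\mathcal{SHIU},\mathrm{AQ})$ both have the same expressive power as unary simple MDDlog.
   Context: **Queries.** A schema $\mathbf{S}$ is a finite set of relation symbols with arities; it is binary if all its symbols have arity one (concept names) or two (role names). An instance $\mathfrak{D}$ over $\mathbf{S}$ is a finite set of facts $R(a_1,\dots,a_n)$, $R\in\mathbf{S}$, with $a_i$ from a fixed countably infinite set of constants; $\mathrm{adom}(\mathfrak{D})$ is the set of constants occurring in $\mathfrak{D}$. An $n$-ary query over $\mathbf{S}$ maps each $\mathbf{S}$-instance $\mathfrak{D}$ to a set $q(\mathfrak{D})\subseteq \mathrm{adom}(\mathfrak{D})^n$. Two queries over $\mathbf{S}$ are equivalent if they agree on all $\mathbf{S}$-instances. A query language is a set of queries. $\mathcal{Q}_2$ is at least as expressive as $\mathcal{Q}_1$ if every query of $\mathcal{Q}_1$ over some schema $\mathbf{S}$ is equivalent to a query of $\mathcal{Q}_2$ over $\mathbf{S}$; they have the same expressive power if this holds in both directions. AQ is the class of atomic queries $A(x)$ with $A$ a unary relation symbol. **Ontology-mediated queries.** An ontology language $\mathcal{L}$ is a set of first-order (FO) sentences; an $\mathcal{L}$-ontology $\mathcal{O}$ is a finite set of sentences of $\mathcal{L}$, and $\mathrm{sig}(\mathcal{O})$ is the set of its relation symbols. An ontology-mediated query is a triple $(\mathbf{S},\mathcal{O},q)$ with $\mathbf{S}$ a schema (the data schema), $\mathcal{O}$ an ontology and $q$ a query over $\mathbf{S}\cup\mathrm{sig}(\mathcal{O})$.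 A finite relational structure over a schema is a pair $(\mathrm{dom},\mathfrak{D})$ with $\mathrm{dom}$ a finite non-empty set and $\mathfrak{D}$ an instance over the schema with $\mathrm{adom}(\mathfrak{D})\subseteq\mathrm{dom}$. The triple defines the query over $\mathbf{S}$ that maps $\mathfrak{D}$ to the set of certain answers: all $\mathbf{a}\in\mathrm{adom}(\mathfrak{D})^n$ such that $\mathbf{a}\in q(\mathfrak{D}')$ for every finite relational structure $(\mathrm{dom},\mathfrak{D}')$ over $\mathbf{S}\cup\mathrm{sig}(\mathcal{O})$ that satisfies $\mathcal{O}$ and has $\mathfrak{D}\subseteq\mathfrak{D}'$. $(\mathcal{L},\mathcal{Q})$ denotes the query language of all queries defined by ontology-mediated queries $(\mathbf{S},\mathcal{O},q)$ with $\mathcal{O}$ an $\mathcal{L}$-ontology and $q\in\mathcal{Q}$. **Description logics.** $\mathcal{ALC}$-concepts: $C,D::=A\mid\top\mid\bot\mid\neg C\mid C\sqcap D\mid C\sqcup D\mid\exists R.C\mid\forall R.C$ with $A$ a concept name, $R$ a role name. They translate to FO formulas with one free variable: $A^*(x)=A(x)$; $\top,\bot$ and Booleans as expected; $(\exists R.C)^*(x)=\exists y(R(x,y)\wedge C^*(y))$; $(\forall R.C)^*(x)=\forall y(R(x,y)\to C^*(y))$. An $\mathcal{ALC}$-ontology is a finite set of concept inclusions $C\sqsubseteq D$, read as $\forall x(C^*(x)\to D^*(x))$. $\mathcal{ALCU}$ additionally allows in concepts the universal role $U$ (a logical symbol, in no schema), interpreted as $\mathrm{dom}\times\mathrm{dom}$.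 $\mathcal{SHIU}$ extends $\mathcal{ALCU}$ by allowing ontologies to contain also statements that a role name is interpreted as a transitive relation, role inclusions $\forall xy(R(x,y)\to S(x,y))$, and inverse-role statements $\forall xy(R(x,y)\leftrightarrow S(y,x))$. **MDDlog.** A disjunctive datalog rule has the form $S_1(\mathbf{x}_1)\vee\cdots\vee S_m(\mathbf{x}_m)\leftarrow R_1(\mathbf{y}_1)\wedge\cdots\wedge R_n(\mathbf{y}_n)$, $m\ge 0$, $n>0$, where every head variable occurs in the body (empty head: $\bot$). A disjunctive datalog (DDlog) program $\Pi$ is a finite set of such rules with a selected predicate $\mathsf{goal}$ that does not occur in rule bodies and occurs in heads only in rules $\mathsf{goal}(\mathbf{x})\leftarrow R_1(\mathbf{x}_1)\wedge\cdots\wedge R_n(\mathbf{x}_n)$. Relation symbols occurring in some rule head are IDB predicates, the others EDB predicates. $\Pi$ defines the query $q_\Pi$ over the schema of its EDB predicates: $q_\Pi(\mathfrak{D})$ is the set of $\mathbf{a}\in\mathrm{adom}(\mathfrak{D})^n$ ($n$ the arity of $\mathsf{goal}$) with $\mathsf{goal}(\mathbf{a})\in\mathfrak{D}'$ for all instances $\mathfrak{D}'\supseteq\mathfrak{D}$ over the IDB and EDB predicates satisfying all rules of $\Pi$. $\Pi$ is an MDDlog program if all IDB predicates except possibly $\mathsf{goal}$ are unary. It is unary if $\mathsf{goal}$ is unary, and simple if each rule contains at most one atom $R(\mathbf{x})$ with $R$ an EDB relation and, in this atom, every variable occurs at most once. ''Unary simple MDDlog'' is the language of queries defined by unary simple MDDlog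 programs. *)

(* Defs.v *)
From HB Require Import structures.
From mathcomp Require Import all_boot.
From mathcomp Require Import finmap.
From Stdlib Require List.

Set Implicit Arguments.
Unset Strict Implicit.
Unset Printing Implicit Defensive.

Local Open Scope fset_scope.

(* A relation symbol is a pair (identifier, arity), so there are countably many
   symbols of every arity. *)
Notation relsym := (nat * nat)%type (only parsing).

Definition arity (R : relsym) : nat := R.2.

Notation const := nat (only parsing).
Notation var := nat (only parsing).

Definition schema : Type := {fset relsym}.

Definition binary_schema (S : schema) : bool :=
  all (fun R => (arity R == 1) || (arity R == 2)) S.

Definition fact : Type := {R : relsym & (arity R).-tuple const}.
HB.instance Definition _ := Countable.on fact.

Definition atom : Type := {R : relsym & (arity R).-tuple var}.
HB.instance Definition _ := Countable.on atom.

Definition mk_fact (R : relsym) (t : (arity R).-tuple const) : fact := existT _ R t.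

Definition mk_atom (R : relsym) (t : (arity R).-tuple var) : atom := existT _ R t.

Definition ground (nu : var -> const) (a : atom) : fact :=
  mk_fact (map_tuple nu (tagged a)).

Record instance (S : schema) : Type := Instance {
  facts :> {fset fact};
  facts_over : all (fun f => tag f \in S) facts
}.

Definition adom (S : schema) (D : instance S) : pred const :=
  fun c => has (fun f : fact => c \in tagged f) (facts D).

Record query (S : schema) (n : nat) : Type := Query {
  answers :> instance S -> n.-tuple const -> Prop;
  answers_adom : forall D t, answers D t -> {subset t <= adom D}
}.

Definition equivalent (S : schema) (n : nat) (q1 q2 : query S n) : Prop :=
  forall D t, q1 D t <-> q2 D t.

(* A set of queries, of all arities and over all schemas. *)
Definition query_language : Type := forall (S : schema) (n : nat), query S n -> Prop.

Definition at_least_as_expressive (Q2 Q1 : query_language) : Prop :=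
  forall S n (q1 : query S n), Q1 S n q1 ->
    exists2 q2 : query S n, Q2 S n q2 & equivalent q1 q2.

Definition same_expressive_power (Q1 Q2 : query_language) : Prop :=
  at_least_as_expressive Q2 Q1 /\ at_least_as_expressive Q1 Q2.

Definition over_binary_schemas (Q : query_language) : query_language :=
  fun S n q => binary_schema S /\ Q S n q.

Lemma atomic_answers_adom (S : schema) (A : relsym) (D : instance S)
    (t : (arity A).-tuple const) :
  mk_fact t \in facts D -> {subset t <= adom D}.
Proof. by move=> tD c ct; apply/hasP; exists (mk_fact t). Qed.

Definition atomic_query (S : schema) (A : relsym) : query S (arity A) :=
  Query (@atomic_answers_adom S A).

Variant AQ : query_language :=
  | AQ_atomic (S : schema) (A : relsym) of A \in S & arity A = 1 :
      AQ (atomic_query S A).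

(* First-order logic over relational signatures, with equality. *)
Inductive fo : Type :=
  | FTrue
  | FFalse
  | FAtom of atom
  | FEq of var & var
  | FNot of fo
  | FAnd of fo & fo
  | FOr of fo & fo
  | FImp of fo & fo
  | FEx of var & fo
  | FAll of var & fo.

Fixpoint fo_fv (phi : fo) : seq var :=
  match phi with
  | FTrue | FFalse => [::]
  | FAtom a => tagged a
  | FEq x y => [:: x; y]
  | FNot p => fo_fv p
  | FAnd p q | FOr p q | FImp p q => fo_fv p ++ fo_fv q
  | FEx x p | FAll x p => [seq y <- fo_fv p | y != x]
  end.

Definition sentence (phi : fo) : bool := fo_fv phi == [::].

Fixpoint fo_sig (phi : fo) : {fset relsym} :=
  match phi with
  | FTrue | FFalse | FEq _ _ => fset0
  | FAtom a => [fset tag a]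
  | FNot p | FEx _ p | FAll _ p => fo_sig p
  | FAnd p q | FOr p q | FImp p q => fo_sig p `|` fo_sig q
  end.

Record structure (S : schema) : Type := Structure {
  dom : {fset const};
  dom_neq0 : dom != fset0;
  interp :> instance S;
  adom_dom : {subset adom interp <= dom}
}.

Fixpoint sat (S : schema) (M : structure S) (nu : var -> const) (phi : fo) : Prop :=
  match phi with
  | FTrue => True
  | FFalse => False
  | FAtom a => ground nu a \in facts M
  | FEq x y => nu x = nu y
  | FNot p => ~ sat M nu p
  | FAnd p q => sat M nu p /\ sat M nu q
  | FOr p q => sat M nu p \/ sat M nu q
  | FImp p q => sat M nu p -> sat M nu q
  | FEx x p => exists2 c, c \in dom M & sat M [eta nu with x |-> c] p
  | FAll x p => forall c, c \in dom M -> sat M [eta nu with x |-> c] p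
  end.

Record ontology_language : Type := OntologyLanguage {
  in_language :> fo -> Prop;
  in_language_sentence : forall phi, in_language phi -> sentence phi
}.

(* A finite set of sentences, given as a list. *)
Record ontology (L : ontology_language) : Type := Ontology {
  axioms :> seq fo;
  axioms_in : List.Forall L axioms
}.

Definition ont_sig (O : seq fo) : {fset relsym} := \bigcup_(phi <- O) fo_sig phi.

(* The axioms being sentences, the choice of the assignment is immaterial. *)
Definition models (S : schema) (M : structure S) (O : seq fo) : Prop :=
  forall nu : var -> const, (forall x, nu x \in dom M) -> List.Forall (sat M nu) O.

Section CertainAnswers.
Variables (S : schema) (O : seq fo) (n : nat) (q : query (S `|` ont_sig O) n).

Definition certain_answers (D : instance S) (t : n.-tuple const) : Prop :=
  {subset t <= adom D} /\
  forall M : structure (S `|` ont_sig O),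
    models M O -> facts D `<=` facts M -> q M t.

Lemma certain_answers_adom (D : instance S) (t : n.-tuple const) :
  certain_answers D t -> {subset t <= adom D}.
Proof. by case. Qed.

Definition omq_query : query S n := Query certain_answers_adom.
End CertainAnswers.

Variant omq_language (L : ontology_language) (Q : query_language) : query_language :=
  | OMQ (S : schema) (O : ontology L) (n : nat) (q : query (S `|` ont_sig O) n)
      of Q (S `|` ont_sig O) n q : omq_language L Q (omq_query q).

(* Concept names and role names are identifiers of unary and binary symbols. *)
Definition concept_name (k : nat) : relsym := (k, 1).
Definition role_name (k : nat) : relsym := (k, 2).

Variant role : Type := RName of nat | RUniv.

Inductive concept : Type :=
  | CName of nat
  | CTop
  | CBot
  | CNot of concept
  | CAnd of concept & concept
  | COr of concept & concept
  | CEx of role & concept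
  | CAll of role & concept.

Definition concept_atom (A : nat) (x : var) : fo :=
  FAtom (@mk_atom (concept_name A) [tuple x]).

Definition role_atom (R : nat) (x y : var) : fo :=
  FAtom (@mk_atom (role_name R) [tuple x; y]).

(* The universal role relates all pairs of domain elements and belongs to no
   signature. *)
Definition role_fo (r : role) (x y : var) : fo :=
  match r with RName R => role_atom R x y | RUniv => FTrue end.

(* [concept_fo C x] has no free variable other than [x], so [x.+1] is fresh
   where it is bound below. *)
Fixpoint concept_fo (C : concept) (x : var) : fo :=
  match C with
  | CName A => concept_atom A x
  | CTop => FTrue
  | CBot => FFalse
  | CNot C => FNot (concept_fo C x)
  | CAnd C D => FAnd (concept_fo C x) (concept_fo D x)
  | COr C D => FOr (concept_fo C x) (concept_fo D x)
  | CEx r C => FEx x.+1 (FAnd (role_fo r x x.+1) (concept_fo C x.+1))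
  | CAll r C => FAll x.+1 (FImp (role_fo r x x.+1) (concept_fo C x.+1))
  end.

Definition concept_inclusion (C D : concept) : fo :=
  FAll 0 (FImp (concept_fo C 0) (concept_fo D 0)).

Definition transitivity (R : nat) : fo :=
  FAll 0 (FAll 1 (FAll 2
    (FImp (FAnd (role_atom R 0 1) (role_atom R 1 2)) (role_atom R 0 2)))).

Definition role_inclusion (R S : nat) : fo :=
  FAll 0 (FAll 1 (FImp (role_atom R 0 1) (role_atom S 0 1))).

Definition inverse_roles (R S : nat) : fo :=
  FAll 0 (FAll 1 (FAnd (FImp (role_atom R 0 1) (role_atom S 1 0))
                       (FImp (role_atom S 1 0) (role_atom R 0 1)))).

Variant ALCU_sentence : fo -> Prop :=
  | ALCU_inclusion (C D : concept) : ALCU_sentence (concept_inclusion C D).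

Variant SHIU_sentence : fo -> Prop :=
  | SHIU_ALCU (phi : fo) of ALCU_sentence phi : SHIU_sentence phi
  | SHIU_transitivity (R : nat) : SHIU_sentence (transitivity R)
  | SHIU_role_inclusion (R S : nat) : SHIU_sentence (role_inclusion R S)
  | SHIU_inverse_roles (R S : nat) : SHIU_sentence (inverse_roles R S).

Lemma fo_fv_concept (C : concept) (x : var) : all (pred1 x) (fo_fv (concept_fo C x)).
Proof.
elim: C x => [A|||C IH|C IHC D IHD|C IHC D IHD|r C IH|r C IH] x //=;
  try by rewrite all_cat IHC IHD.
- by rewrite andbT; apply/eqP.
- rewrite all_filter all_cat; apply/andP; split; last first.
    by apply: sub_all (IH x.+1) => y /eqP ->; apply/implyP => /eqP.
  by case: r => //= R; do !(apply/andP; split=> //); apply/implyP => // /eqP.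
- rewrite all_filter all_cat; apply/andP; split; last first.
    by apply: sub_all (IH x.+1) => y /eqP ->; apply/implyP => /eqP.
  by case: r => //= R; do !(apply/andP; split=> //); apply/implyP => // /eqP.
Qed.

Lemma ALCU_sentenceP phi : ALCU_sentence phi -> sentence phi.
Proof.
case=> C D; rewrite /sentence /= -[_ == _]negbK -has_filter -all_predC.
rewrite all_cat; apply/andP.
by split; [apply: sub_all (fo_fv_concept C 0) | apply: sub_all (fo_fv_concept D 0)];
  move=> y /= ->.
Qed.

Lemma SHIU_sentenceP phi : SHIU_sentence phi -> sentence phi.
Proof. by case=> // psi /ALCU_sentenceP. Qed.

Definition ALCU : ontology_language := OntologyLanguage ALCU_sentenceP.
Definition SHIU : ontology_language := OntologyLanguage SHIU_sentenceP.

Definition atoms_vars (s : seq atom) : seq var :=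
  flatten [seq (tagged a : seq var) | a : atom <- s].

(* Heads are disjunctions, the empty one being falsity; bodies are conjunctions. *)
Record rule : Type := Rule {
  head : seq atom;
  body : seq atom;
  body_neq0 : body != [::];
  head_vars : {subset atoms_vars head <= atoms_vars body}
}.

Definition rule_holds (S : schema) (D : instance S) (r : rule) : Prop :=
  forall nu : var -> const,
    all (fun a => ground nu a \in facts D) (body r) ->
    has (fun a => ground nu a \in facts D) (head r).

Definition occurs_in (R : relsym) (s : seq atom) : bool := has (fun a : atom => tag a == R) s.

Record ddlog : Type := DDlog {
  rules : seq rule;
  goal : relsym;
  goal_body : all (fun r => ~~ occurs_in goal (body r)) rules;
  goal_head : all (fun r => occurs_in goal (head r) ==> (size (head r) == 1)) rules
}.

Definition idb (P : ddlog) : schema :=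
  [fset R in flatten [seq [seq tag a | a <- head r] | r <- rules P]].

(* As idb covers the heads, it suffices to look at the symbols in bodies. *)
Definition edb (P : ddlog) : schema :=
  [fset R in flatten [seq [seq tag a | a <- body r] | r <- rules P]] `\` idb P.

Section DDlogAnswers.
Variable P : ddlog.

Definition ddlog_answers (D : instance (edb P))
    (t : (arity (goal P)).-tuple const) : Prop :=
  {subset t <= adom D} /\
  forall D' : instance (idb P `|` edb P),
    facts D `<=` facts D' -> List.Forall (rule_holds D') (rules P) ->
    mk_fact t \in facts D'.

Lemma ddlog_answers_adom D t : ddlog_answers D t -> {subset t <= adom D}.
Proof. by case. Qed.

Definition ddlog_query : query (edb P) (arity (goal P)) := Query ddlog_answers_adom.
End DDlogAnswers.

Definition mddlog (P : ddlog) : bool :=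
  all (fun R => (R != goal P) ==> (arity R == 1)) (idb P).

Definition unary_ddlog (P : ddlog) : bool := arity (goal P) == 1.

Definition simple_ddlog (P : ddlog) : bool :=
  all (fun r =>
         (count (fun a : atom => tag a \in edb P) (body r) <= 1)
         && all (fun a : atom => (tag a \in edb P) ==> uniq (tagged a)) (body r))
      (rules P).

Variant unary_simple_mddlog : query_language :=
  | USMDDlog (P : ddlog) of mddlog P & unary_ddlog P & simple_ddlog P :
      unary_simple_mddlog (ddlog_query P).

(* Main.v *)
(* From MDDlog to ALCU: a clause over unary atoms and at most one binary atom R(x,y) splits
   by variable. If C_z collects the unary literals on z, the rule says
   top [= C_x \/ forall R.C_y \/ \/_z forall U.C_z, with z ranging over the other variables.

   From SHIU to MDDlog: SHIU sentences are equality free, hence invariant under surjective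
   strong homomorphisms. So if the data D maps homomorphically to a model B of the ontology,
   then D extends to a model of which B is a strong homomorphic image. Conversely every model
   extending D maps homomorphically to a model of bounded size with the same unary facts: a
   filtration, taken with the largest relations compatible with the value restrictions so
   that transitivity and role inclusions survive. Thus the certain answers are determined by
   the homomorphisms from D to finitely many finite templates, and a simple program can guess
   such a homomorphism with one unary predicate per template element. *)

From HB Require Import structures.
From mathcomp Require Import all_boot.
From mathcomp Require Import finmap.
Require Import Defs.
From Stdlib Require Import Classical_Prop.
From Stdlib Require List.

Set Implicit Arguments.
Unset Strict Implicit.
Unset Printing Implicit Defensive.

Local Open Scope fset_scope.

(** * Facts and the evaluation of concepts *)

Lemma fact_eq (f g : fact) :
  tag f = tag g -> tagged f = tagged g :> seq nat -> f = g.
Proof.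
case: f g => [R s] [R' t] /= RR'; case: R' / RR' t => t st.
by congr (existT _ R _); apply: val_inj.
Qed.

Definition concept_fact (A c : nat) : fact := @mk_fact (concept_name A) [tuple c].
Definition role_fact (R c d : nat) : fact := @mk_fact (role_name R) [tuple c; d].

Lemma ground_vars (nu : nat -> nat) (a : atom) :
  tagged (ground nu a) = [seq nu x | x <- tagged a] :> seq nat.
Proof. by []. Qed.

Lemma binary_fact (f : fact) : arity (tag f) = 2 ->
  exists c d, tagged f = [:: c; d] :> seq nat /\ f = role_fact (tag f).1 c d.
Proof.
move=> f2; have := etrans (size_tuple (tagged f)) f2.
case E : (tval _) => [|c [|d []]] // _; exists c, d; split=> //.
by apply: fact_eq => //=; move: f2; case: (tag f) => [k n]; rewrite /arity /= => ->.
Qed.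

Lemma ground_tag (nu : nat -> nat) (a : atom) : tag (ground nu a) = tag a.
Proof. by []. Qed.

Lemma ForallP (T : Type) (P : T -> Prop) (s : seq T) :
  List.Forall P s <-> forall x, List.In x s -> P x.
Proof. exact: List.Forall_forall. Qed.

Lemma Forall_cat (T : Type) (P : T -> Prop) (s1 s2 : seq T) :
  List.Forall P (s1 ++ s2) <-> List.Forall P s1 /\ List.Forall P s2.
Proof. exact: List.Forall_app. Qed.

Lemma Forall_map (T U : Type) (f : T -> U) (P : U -> Prop) (s : seq T) :
  List.Forall P (map f s) <-> List.Forall (P \o f) s.
Proof. exact: List.Forall_map. Qed.

Lemma Forall_mem (T : eqType) (P : T -> Prop) (s : seq T) :
  List.Forall P s <-> {in s, forall x, P x}.
Proof.
split; first by elim=> // x l Px _ IH y; rewrite inE => /predU1P [-> | /IH].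
elim: s => [|x s IH] H; constructor; first by apply: H; rewrite mem_head.
by apply: IH => y ys; apply: H; rewrite inE ys orbT.
Qed.

Section ConceptEval.
Variables (F : {fset fact}) (X : {fset nat}).

Definition role_eval (r : role) (c d : nat) : bool :=
  if r is RName R then role_fact R c d \in F else true.

(** Boolean because domain and facts are finite, so that a failing restriction yields an explicit
    counterexample. Facts and domain are separate parameters: the filtration changes the facts over
    a fixed domain. *)
Fixpoint concept_eval (C : concept) (c : nat) : bool :=
  match C with
  | CName A => concept_fact A c \in F
  | CTop => true
  | CBot => false
  | CNot C => ~~ concept_eval C c
  | CAnd C D => concept_eval C c && concept_eval D c
  | COr C D => concept_eval C c || concept_eval D c
  | CEx r C => has (fun d => role_eval r c d && concept_eval C d) X
  | CAll r C => all (fun d => role_eval r c d ==> concept_eval C d) X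
  end.

Lemma concept_eval_bigor (Cs : seq concept) (c : nat) :
  concept_eval (foldr COr CBot Cs) c = has (concept_eval^~ c) Cs.
Proof. by elim: Cs => //= C Cs ->. Qed.
End ConceptEval.

Lemma ground_unary (nu : nat -> nat) (A x : nat) :
  ground nu (@mk_atom (concept_name A) [tuple x]) = concept_fact A (nu x).
Proof. exact: fact_eq. Qed.

Lemma ground_binary (nu : nat -> nat) (R x y : nat) :
  ground nu (@mk_atom (role_name R) [tuple x; y]) = role_fact R (nu x) (nu y).
Proof. exact: fact_eq. Qed.

Section ConceptSat.
Variables (S : schema) (M : structure S).

Lemma sat_role (nu : nat -> nat) (r : role) (x y : nat) :
  sat M nu (role_fo r x y) <-> role_eval (facts M) r (nu x) (nu y).
Proof. by case: r => [R|] //=; rewrite ground_binary. Qed.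

Lemma sat_concept (nu : nat -> nat) (C : concept) (x : nat) :
  sat M nu (concept_fo C x) <-> concept_eval (facts M) (dom M) C (nu x).
Proof.
(* The bound variable [x.+1] differs from [x], so binding it leaves the value at [x] unchanged. *)
have neq (z : nat) : (z == z.+1) = false by elim: z.
elim: C nu x => [A|||C IH|C IHC D IHD|C IHC D IHD|r C IH|r C IH] nu x //=.
- by rewrite ground_unary.
- by rewrite IH; split=> [/negP|/negP].
- by rewrite IHC IHD; split=> [/andP|/andP].
- by rewrite IHC IHD; split=> [/orP|/orP].
- split=> [[c cM [/sat_role rc /IH Cc]]|/hasP [c cM /andP [rc Cc]]].
    apply/hasP; exists c => //; move: rc Cc; rewrite /= neq eqxx => rc Cc.
    by apply/andP.
  by exists c => //; split; [apply/sat_role|apply/IH]; rewrite /= ?neq eqxx.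
- split=> [H|/allP H c cM].
    apply/allP => c cM; apply/implyP => rc.
    have := H c cM; rewrite IH sat_role /= neq eqxx; exact.
  by rewrite IH sat_role /= neq eqxx; apply/implyP/H.
Qed.

Lemma sat_inclusion (nu : nat -> nat) (C D : concept) :
  sat M nu (concept_inclusion C D) <->
  {in dom M, forall c, concept_eval (facts M) (dom M) C c ->
                       concept_eval (facts M) (dom M) D c}.
Proof.
split=> H c cM => [Cc|/sat_concept Cc].
  by have /sat_concept := H c cM (iffRL (sat_concept _ _ _) Cc).
by apply/sat_concept; apply: H Cc.
Qed.
End ConceptSat.

(** * Rules as concept inclusions *)

Section RuleConcept.
Variable r : rule.

(* The unary literals on the variable [z] in the clause [~ body \/ head]. *)
Definition clause (z : nat) : concept :=
  foldr COr CBot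
    ([seq CNot (CName (tag a).1) | a : atom <- body r & (tagged a == [:: z] :> seq nat)] ++
     [seq CName (tag a).1 | a : atom <- head r & (tagged a == [:: z] :> seq nat)]).

(** A universally quantified disjunction splits when its disjuncts share no variable, so each
    variable outside the binary atom gets its own universal-role restriction. Without a binary atom
    the concept holds at all points or at none. *)
Definition rule_concept : concept :=
  let vs := atoms_vars (body r) in
  if [seq a : atom <- body r | arity (tag a) == 2] is a :: _ then
    let x := nth 0 (tagged a) 0 in let y := nth 0 (tagged a) 1 in
    COr (clause x) (COr (CAll (RName (tag a).1) (clause y))
      (foldr COr CBot [seq CAll RUniv (clause z) | z <- vs & z \notin [:: x; y]]))
  else foldr COr CBot [seq CAll RUniv (clause z) | z <- vs].
End RuleConcept.

Lemma ground_vars1 (nu : nat -> nat) (a : atom) (z : nat) :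
  tagged a = [:: z] :> seq nat -> ground nu a = concept_fact (tag a).1 (nu z).
Proof.
case: a => [[k n] t] /= tz; apply: fact_eq => /=; last by rewrite tz.
by have := size_tuple t; rewrite tz /arity /= => <-.
Qed.

Lemma clauseP (F : {fset fact}) (X : {fset nat}) (r : rule) (nu : nat -> nat) (z : nat) :
  reflect ((exists2 a : atom, a \in body r &
              tagged a = [:: z] :> seq nat /\ ground nu a \notin F) \/
           (exists2 a : atom, a \in head r &
              tagged a = [:: z] :> seq nat /\ ground nu a \in F))
          (concept_eval F X (clause r z) (nu z)).
Proof.
rewrite concept_eval_bigor has_cat !has_map.
apply: (iffP orP) => -[] H; [left|right|left|right].
- case/hasP: H => a; rewrite mem_filter => /andP [/eqP az ab] /= Na.
  by exists a => //; rewrite (ground_vars1 nu az).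
- case/hasP: H => a; rewrite mem_filter => /andP [/eqP az ab] /= Na.
  by exists a => //; rewrite (ground_vars1 nu az).
- case: H => a ab [az aF]; apply/hasP; exists a => /=; first by rewrite mem_filter az eqxx.
  by rewrite -(ground_vars1 nu az).
- case: H => a ab [az aF]; apply/hasP; exists a => /=; first by rewrite mem_filter az eqxx.
  by rewrite -(ground_vars1 nu az).
Qed.

Lemma atoms_varsP (s : seq atom) (z : nat) :
  reflect (exists2 a : atom, a \in s & z \in (tagged a : seq nat)) (z \in atoms_vars s).
Proof.
exact: flatten_mapP.
Qed.

Lemma size_vars (a : atom) : size (tagged a) = arity (tag a).
Proof. exact: size_tuple. Qed.

Lemma vars_unary (a : atom) : arity (tag a) = 1 -> exists z, tagged a = [:: z] :> seq nat.
Proof.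
by move=> a1; have := etrans (size_vars a) a1; case: (tval _) => [|z [|]] //; exists z.
Qed.

Section RuleConceptCorrect.
Variables (r : rule) (F : {fset fact}) (X : {fset nat}).
Hypothesis head1 : {in head r, forall a : atom, arity (tag a) = 1}.
Hypothesis body12 :
  {in body r, forall a : atom, arity (tag a) = 1 \/ arity (tag a) = 2 /\ uniq (tagged a)}.
Hypothesis body_binary1 : count (fun a : atom => arity (tag a) == 2) (body r) <= 1.
Hypothesis X0 : X != fset0.
Hypothesis FX : forall f, f \in F -> {subset tagged f <= X}.

Let holds := forall nu : nat -> nat, all (fun a => ground nu a \in F) (body r) ->
    has (fun a => ground nu a \in F) (head r).

Lemma clause_head nu z : all (fun a => ground nu a \in F) (body r) ->
  concept_eval F X (clause r z) (nu z) -> has (fun a => ground nu a \in F) (head r).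
Proof.
move=> /allP ab /clauseP [[a ar [_]]|[a ar [_ aF]]]; first by rewrite (ab a ar).
by apply/hasP; exists a.
Qed.

(** When all clauses fail, every unary body atom is true and every head atom is false, because all
    head variables occur in the body. With the binary atoms true as well, [nu] violates the rule. *)
Lemma clause_falsify nu :
  {in atoms_vars (body r), forall z, ~~ concept_eval F X (clause r z) (nu z)} ->
  {in body r, forall a : atom, arity (tag a) = 2 -> ground nu a \in F} -> ~ holds.
Proof.
move=> Nc b2 /(_ nu) H.
have {}/H : all (fun a => ground nu a \in F) (body r).
  apply/allP => a ar; case: (body12 ar) => [/vars_unary [z az]|[a2 _]]; last exact: b2.
  apply: contraT => aF; have zr : z \in atoms_vars (body r).
    by apply/atoms_varsP; exists a => //; rewrite az inE.
  by case/clauseP: (Nc z zr); left; exists a.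
case/hasP=> a ar aF; have [z az] := vars_unary (head1 ar).
have zr : z \in atoms_vars (body r).
  by apply: (head_vars (r := r)); apply/atoms_varsP; exists a => //; rewrite az inE.
by case/clauseP: (Nc z zr); right; exists a.
Qed.

(** The first point of [X] falsifying the clause; the default 0 is reached only when there is
    none. *)
Let counterexample z :=
  nth 0 [seq c <- X | ~~ concept_eval F X (clause r z) c] 0.

Let counterexampleP z : ~~ concept_eval F X (CAll RUniv (clause r z)) 0 ->
  ~~ concept_eval F X (clause r z) (counterexample z).
Proof.
move=> /= /allPn [c cX Nc]; rewrite /counterexample.
have : c \in [seq c <- X | ~~ concept_eval F X (clause r z) c].
  by rewrite mem_filter Nc.
case E : [seq _ <- _ | _] => [//|d s] _ /=.
have : d \in d :: s by rewrite mem_head.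
by rewrite -E mem_filter => /andP [].
Qed.

(** Left to right, a point where the concept fails is completed to an assignment falsifying each
    clause, which contradicts the rule. Right to left, at an assignment satisfying the body,
    whichever disjunct holds has a true literal; it cannot be a negated body atom, so it is a head
    atom. *)
Lemma rule_conceptP : holds <-> {in X, forall c, concept_eval F X (rule_concept r) c}.
Proof.
have inX nu z : all (fun a => ground nu a \in F) (body r) ->
    z \in atoms_vars (body r) -> nu z \in X.
  move=> /allP b /atoms_varsP [a ar za]; apply: (FX (b a ar)).
  exact: (map_f nu za).
rewrite /rule_concept; case E : [seq _ <- _ | _] => [|a s].
  have b2 : {in body r, forall a : atom, arity (tag a) <> 2}.
    move=> a ar a2; have : a \in [seq a : atom <- body r | arity (tag a) == 2].
      by rewrite mem_filter a2.
    by rewrite E.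
  split=> [H c cX|H nu b].
    apply: contraT => N; exfalso; apply: (clause_falsify (nu := counterexample)) H.
      move=> z zr; apply: counterexampleP; apply: contra N => N.
      by rewrite concept_eval_bigor has_map; apply/hasP; exists z.
    by move=> a /b2.
  (* The disjuncts do not depend on the point, but some point is needed to evaluate them. *)
  have /fset0Pn [c cX] := X0.
  move: (H c cX); rewrite concept_eval_bigor has_map => /hasP [z zr] /allP /= Hz.
  exact: clause_head b (Hz _ (inX _ _ b zr)).
have : a \in [seq a : atom <- body r | arity (tag a) == 2] by rewrite E mem_head.
rewrite mem_filter => /andP [/eqP a2 ar].
have s0 : s = [::].
  by move: body_binary1; rewrite -size_filter E; case: (s).
have ba : {in body r, forall b : atom, arity (tag b) = 2 -> b = a}.
  move=> b br b2; have : b \in [seq a : atom <- body r | arity (tag a) == 2].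
    by rewrite mem_filter b2.
  by rewrite E s0 inE => /eqP.
have [x [y [xy axy]]] : exists x y, x != y /\ tagged a = [:: x; y] :> seq nat.
  case: (body12 ar) => [a1|[_]]; first by have := etrans (esym a1) a2.
  have := etrans (size_vars a) a2; case: (tval _) => [|x [|y []]] //= _.
  by rewrite inE andbT; exists x, y.
have ga nu : ground nu a = role_fact (tag a).1 (nu x) (nu y).
  apply: fact_eq; last by rewrite ground_vars axy.
  by rewrite ground_tag; move: a2; case: (tag a) => ? ? /= ->.
have xr : x \in atoms_vars (body r) by apply/atoms_varsP; exists a; rewrite ?axy ?inE ?eqxx.
have yr : y \in atoms_vars (body r) by apply/atoms_varsP; exists a; rewrite ?axy ?inE ?eqxx ?orbT.
rewrite axy /=; split=> [H c cX|H nu b].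
  apply: contraT; rewrite negb_or => /andP [Nx]; rewrite negb_or => /andP [].
  case/allPn=> d dX; rewrite negb_imply => /andP [Rcd Ny] N.
  (* [c] is the point where the concept fails, [d] a successor falsifying the clause of [y]; every
     other variable takes its own counterexample. *)
  exfalso; pose nu z := if z == x then c else if z == y then d else counterexample z.
  have nux : nu x = c by rewrite /nu eqxx.
  have nuy : nu y = d by rewrite /nu eq_sym (negPf xy) eqxx.
  apply: (clause_falsify (nu := nu)) H => [z zr|b br b2]; last first.
    by rewrite (ba b br b2) ga nux nuy.
  rewrite /nu; case: eqP => [->//|/eqP zx]; case: eqP => [->//|/eqP zy].
  apply: counterexampleP; apply: contra N => N.
  rewrite concept_eval_bigor has_map; apply/hasP; exists z => //.
  by rewrite mem_filter !inE (negPf zx) (negPf zy).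
case/or3P: (H _ (inX _ _ b xr)) => [|/allP /(_ _ (inX _ _ b yr))|].
- exact: clause_head.
- rewrite -ga (allP b a ar) /=; exact: clause_head.
rewrite concept_eval_bigor has_map => /hasP [z]; rewrite mem_filter => /andP [_ zr].
move=> /allP /= Hz; exact: clause_head b (Hz _ (inX _ _ b zr)).
Qed.
End RuleConceptCorrect.

(** * From simple MDDlog programs to ALCU ontologies *)

Lemma restriction_over (S : schema) (F : {fset fact}) :
  all (fun f : fact => tag f \in S) [fset f : fact in F | tag f \in S].
Proof. by apply/allP => f; rewrite !inE => /andP []. Qed.

Definition restriction (S : schema) (F : {fset fact}) : instance S :=
  Instance (restriction_over S F).

Lemma restrictionE (S : schema) (F : {fset fact}) (f : fact) :
  (f \in facts (restriction S F)) = (f \in F) && (tag f \in S).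
Proof. by rewrite !inE. Qed.

Lemma factsP (S : schema) (D : instance S) (f : fact) : f \in facts D -> tag f \in S.
Proof. exact: (allP (facts_over D)). Qed.

Lemma facts_adom (S : schema) (D : instance S) (f : fact) :
  f \in facts D -> {subset tagged f <= adom D}.
Proof. by move=> fD c cf; apply/hasP; exists f. Qed.

Lemma facts_dom (S : schema) (M : structure S) (f : fact) :
  f \in facts M -> {subset tagged f <= dom M}.
Proof. by move=> fM c cf; apply: (adom_dom (facts_adom fM cf)). Qed.

Lemma adom_sub (S1 S2 : schema) (D1 : instance S1) (D2 : instance S2) :
  facts D1 `<=` facts D2 -> {subset adom D1 <= adom D2}.
Proof. by move=> /fsubsetP sD c /hasP [f /sD fD cf]; apply/hasP; exists f. Qed.

Lemma models_Forall (S : schema) (M : structure S) (O : seq fo) :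
  models M O <->
  List.Forall (fun phi => forall nu, (forall x, nu x \in dom M) -> sat M nu phi) O.
Proof.
rewrite ForallP; split=> [H phi phiO nu nuM|H nu nuM].
  by move: (H nu nuM) => /ForallP; apply.
by apply/ForallP => phi /H; apply.
Qed.

Lemma holds_inclusion (S : schema) (M : structure S) (C D : concept) :
  (forall nu, (forall x, nu x \in dom M) -> sat M nu (concept_inclusion C D)) <->
  {in dom M, forall c, concept_eval (facts M) (dom M) C c ->
                       concept_eval (facts M) (dom M) D c}.
Proof.
have /fset0Pn [c cM] := dom_neq0 M.
split=> [H|H nu _]; last exact/sat_inclusion.
by apply/(sat_inclusion M (fun=> c))/H.
Qed.

Section ProgramSymbols.
Variable P : ddlog.

Lemma head_idb r a : List.In r (rules P) -> a \in Defs.head r -> tag a \in idb P.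
Proof.
rewrite /idb in_fset; elim: (rules P) => //= r' rs IH [->|/IH {}IH] ar.
  by rewrite mem_cat (map_f (fun a : atom => tag a) ar).
by rewrite mem_cat IH ?orbT.
Qed.

Lemma body_symbols r a : List.In r (rules P) -> a \in body r -> tag a \in idb P `|` edb P.
Proof.
move=> rP ar; rewrite in_fsetU /edb in_fsetD; case: (boolP (tag a \in idb P)) => //= _.
rewrite in_fset; elim: (rules P) rP => //= r' rs IH [->|/IH {}IH].
  by rewrite mem_cat (map_f (fun a : atom => tag a) ar).
by rewrite mem_cat IH ?orbT.
Qed.
End ProgramSymbols.

Lemma all_In (T : Type) (p : pred T) (s : seq T) x : all p s -> List.In x s -> p x.
Proof. by elim: s => //= y s IH /andP [py /IH {}IH] [<-|]. Qed.

Section MDDlogToALCU.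
Variable P : ddlog.
Hypothesis P_mddlog : mddlog P.
Hypothesis P_unary : unary_ddlog P.
Hypothesis P_simple : simple_ddlog P.
Hypothesis P_binary : binary_schema (edb P).

Lemma idb_unary R : R \in idb P -> arity R = 1.
Proof.
move/(allP P_mddlog); case: eqP => [-> _|_ /eqP //]; exact/eqP.
Qed.

(** All IDB symbols, [goal] included, are unary, so a binary atom is an EDB atom; simplicity bounds
    the number of these and makes their variables distinct. *)
Let rule_conditions r : List.In r (rules P) ->
  [/\ {in Defs.head r, forall a : atom, arity (tag a) = 1},
      {in body r, forall a : atom, arity (tag a) = 1 \/ arity (tag a) = 2 /\ uniq (tagged a)} &
      count (fun a : atom => arity (tag a) == 2) (body r) <= 1].
Proof.
move=> rP; have /andP [cnt /allP un] := all_In P_simple rP.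
have edb2 : {in body r, forall a : atom, arity (tag a) = 2 -> tag a \in edb P}.
  move=> a ar a2; have := body_symbols rP ar; rewrite in_fsetU => /orP [/idb_unary|//].
  by move=> a1; have := etrans (esym a1) a2.
split=> [a /(head_idb rP)/idb_unary //|a ar|].
  have := body_symbols rP ar; rewrite in_fsetU => /orP [/idb_unary|aE]; first by left.
  case/orP: (allP P_binary _ aE) => /eqP; [by left | right; split=> //].
  by have := un a ar; rewrite aE.
apply: leq_trans cnt; rewrite -!size_filter.
have -> : [seq a <- body r | arity (tag a) == 2] =
  [seq a <- [seq a <- body r | tag a \in edb P] | arity (tag a) == 2].
  rewrite -filter_predI; apply: eq_in_filter => a ar /=.
  by case: eqP => //= /(edb2 a ar) ->.
by rewrite [leqLHS]size_filter; apply: count_size.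
Qed.

(** The second group consists of tautologies that put [goal] and the IDB symbols into the signature
    of the ontology. *)
Definition alcu_axioms : seq fo :=
  [seq concept_inclusion CTop (rule_concept r) | r <- rules P] ++
  [seq concept_inclusion (CName R.1) CTop | R <- goal P :: idb P].

Lemma alcu_axioms_in : List.Forall ALCU alcu_axioms.
Proof.
by apply/Forall_cat; split; apply/Forall_map/ForallP => ? _ /=; constructor.
Qed.

Definition alcu_ontology : ontology ALCU := Ontology alcu_axioms_in.

Let sig := edb P `|` ont_sig alcu_ontology.

Lemma idb_goal_sig R : R \in goal P :: idb P -> R \in sig.
Proof.
move=> Rin; have R1 : arity R = 1.
  by move: Rin; rewrite inE => /predU1P [->|/idb_unary //]; apply/eqP.
rewrite in_fsetU; apply/orP; right.
rewrite -[R \in _]/(R \in ont_sig alcu_axioms) /ont_sig big_cat in_fsetU.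
apply/orP; right; rewrite big_map.
move: Rin R1; elim: (goal P :: idb P) => // R' s IH; rewrite big_cons in_fsetU inE.
case/predU1P=> [->|/IH {}IH /IH ->]; last by rewrite orbT.
by case: R' => [k n]; rewrite /arity /= => ->; rewrite !in_fsetU in_fset1 eqxx.
Qed.

Lemma alcu_models (M : structure sig) :
  models M alcu_ontology <->
  List.Forall (fun r => forall nu : nat -> nat,
    all (fun a => ground nu a \in facts M) (body r) ->
    has (fun a => ground nu a \in facts M) (Defs.head r)) (rules P).
Proof.
have E r : List.In r (rules P) -> _ := fun rP =>
  let: And3 h b c := rule_conditions rP in
  rule_conceptP h b c (dom_neq0 M) (@facts_dom _ M).
rewrite models_Forall Forall_cat !Forall_map; split=> [[/ForallP H _]|/ForallP H].
  by apply/ForallP => r rP; apply/(E r rP) => c cM; have /holds_inclusion := H r rP; apply.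
split; apply/ForallP => x xP; apply/holds_inclusion => //= c cM _.
by apply: (iffLR (E x xP)) cM; apply: H.
Qed.

(** A model of the ontology, restricted to the symbols of the program, satisfies the rules;
    conversely an instance satisfying the rules becomes a model of the ontology once a finite domain
    is put around it. *)
Lemma alcu_equivalent :
  equivalent (ddlog_query P) (omq_query (atomic_query sig (goal P))).
Proof.
move=> D t; split=> -[tD H]; split=> // M.
  move=> /alcu_models /ForallP MO sDM; rewrite /atomic_query /=.
  have : mk_fact t \in facts (restriction (idb P `|` edb P) (facts M)).
    apply: H.
      apply/fsubsetP => f fD; rewrite restrictionE (fsubsetP sDM) //=.
      by rewrite in_fsetU (factsP fD) orbT.
    apply/ForallP => r rP nu /allP b; have /(MO r rP nu) /hasP [a ar aM] :
        all (fun a => ground nu a \in facts M) (body r).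
      by apply/allP => a /b; rewrite restrictionE => /andP [].
    apply/hasP; exists a => //; rewrite restrictionE aM /=.
    by rewrite in_fsetU (head_idb rP ar).
  by rewrite restrictionE => /andP [].
move=> sDM MP.
have over : all (fun f : fact => tag f \in sig) (facts M).
  apply/allP => f /factsP; rewrite in_fsetU => /orP [fi|fe].
    by apply: idb_goal_sig; rewrite inE fi orbT.
  by rewrite in_fsetU fe.
pose D' : instance sig := Instance over.
(* The element 0 keeps the domain non-empty when there are no facts. *)
pose X : {fset nat} := 0 |` [fset c in flatten [seq (tagged f : seq nat) | f : fact <- facts M]].
have X0 : X != fset0 by apply/fset0Pn; exists 0; rewrite in_fsetU in_fset1 eqxx.
have DX : {subset adom D' <= X}.
  move=> c /hasP [f fM cf]; rewrite in_fsetU; apply/orP; right; rewrite in_fset.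
  by apply/flatten_mapP; exists f.
by apply: (H (Structure X0 DX)) => //; apply/alcu_models.
Qed.

Lemma alcu_omq : omq_language ALCU AQ (omq_query (atomic_query sig (goal P))).
Proof.
constructor; constructor; first by apply: idb_goal_sig; rewrite mem_head.
exact/eqP.
Qed.
End MDDlogToALCU.

Lemma mddlog_le_alcu :
  at_least_as_expressive (over_binary_schemas (omq_language ALCU AQ))
    (over_binary_schemas unary_simple_mddlog).
Proof.
move=> S n q [+ Pq]; case: Pq => P Pm Pu Ps Pb.
eexists; last exact: alcu_equivalent.
by split=> //; apply: alcu_omq.
Qed.

Lemma alcu_le_shiu :
  at_least_as_expressive (over_binary_schemas (omq_language SHIU AQ))
    (over_binary_schemas (omq_language ALCU AQ)).
Proof.
move=> S n q [Sb Oq]; exists q => //; split=> //; case: Oq => {n q Sb}S O n q qA.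
have O_SHIU : List.Forall SHIU (axioms O).
  by apply: List.Forall_impl (axioms_in O) => phi; apply: SHIU_ALCU.
exact: (@OMQ SHIU _ S (Ontology O_SHIU)).
Qed.

(** * Programs that guess a homomorphism to a template *)

Fixpoint words (T : eqType) (X : seq T) (n : nat) : seq (seq T) :=
  if n is n'.+1 then [seq x :: w | x <- X, w <- words X n'] else [:: [::]].

Lemma mem_words (T : eqType) (X : seq T) n w : (w \in words X n) = (size w == n) && all (mem X) w.
Proof.
elim: n w => [|n IH] [|x w] //=.
  by apply/allpairsP => -[[y v] /= []].
rewrite eqSS andbCA -IH; apply/allpairsP/andP => [[[y v] /= [yX vX [-> ->]]]|[xX wX]] //.
by exists (x, w).
Qed.

Definition facts_on (S : schema) (X : {fset nat}) : {fset fact} :=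
  [fset f in flatten [seq [seq @mk_fact R t | t <- pmap insub (words X (arity R))] | R <- S]].

Lemma mem_facts_on S X f :
  (f \in facts_on S X) = (tag f \in S) && all (mem X) (tagged f).
Proof.
rewrite in_fset; apply/flatten_mapP/andP => [[R RS /mapP [u + ->]]|].
  by rewrite mem_pmap_sub mem_words => /andP [_ uX].
case: f => R t /= [RS tX]; exists R => //; apply: map_f; rewrite mem_pmap_sub mem_words /=.
by rewrite (size_tuple t) eqxx.
Qed.

Definition fact_image (h : nat -> nat) (f : fact) : fact := mk_fact (map_tuple h (tagged f)).

Lemma fact_image_vars h f : tagged (fact_image h f) = [seq h c | c <- tagged f] :> seq nat.
Proof. by []. Qed.

Lemma fact_image_concept h A c : fact_image h (concept_fact A c) = concept_fact A (h c).
Proof. exact: fact_eq. Qed.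

Definition rule_spec (r : rule) : seq atom * seq atom := (Defs.head r, body r).

(** Rules contain proofs, so the program is first described by plain head-body pairs; the rules are
    recovered here. *)
Lemma rules_of_specs (specs : seq (seq atom * seq atom)) :
  {in specs, forall s, s.2 != [::] /\ {subset atoms_vars s.1 <= atoms_vars s.2}} ->
  exists rs, [seq rule_spec r | r <- rs] = specs.
Proof.
elim: specs => [|[hd bd] specs IH] wf; first by exists [::].
have [b0 hv] := wf _ (mem_head _ _).
have [|rs rsE] := IH; first by move=> s ss; apply: wf; rewrite inE ss orbT.
by exists (Rule b0 hv :: rs); rewrite /= rsE.
Qed.

(** A structure stripped to its domain and facts, so that templates form a countable type and can be
    encoded in predicate names. *)
Definition template : Type := ({fset nat} * {fset fact})%type.

Section TemplateProgram.
Variables (S : schema) (Ts : seq template) (A : nat).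
Hypothesis S_pos : {in S, forall R, 0 < arity R}.

Let label : Type := (template * nat)%type.

Definition labels : seq label := [seq (T, b) | T : template <- Ts, b : nat <- enum_fset T.1].

Lemma mem_labels T b : ((T, b) \in labels) = (T \in Ts) && (b \in T.1).
Proof.
by apply/allpairsPdep/andP => [[T' [b' [? ? [-> ->]]]]|[? ?]] //; exists T, b.
Qed.

(** Exceeds every identifier in [S], hence is fresh at every arity; label names are placed above it,
    with [pickle] keeping them distinct. *)
Definition goal_name : nat := (\max_(R <- S) R.1).+1.
Definition label_name (l : label) : nat := goal_name.+1 + choice.pickle l.

Lemma label_name_inj : injective label_name.
Proof. by move=> l l' /addnI /(pcan_inj choice.pickleK). Qed.

Lemma label_goal l : label_name l = goal_name -> False.
Proof. by move=> e; have := leqnn goal_name; rewrite -{1}e /label_name addSn ltnNge leq_addr. Qed.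

Lemma schema_name k n : (k, n) \in S -> k < goal_name.
Proof. by move=> kS; exact: (leq_bigmax_seq (F := fst) (k, n)). Qed.

Lemma goal_fresh n : (goal_name, n) \notin S.
Proof. by apply/negP => /schema_name; rewrite ltnn. Qed.

Lemma label_fresh l n : (label_name l, n) \notin S.
Proof.
by apply/negP => /schema_name; rewrite ltnNge /label_name leqW ?leq_addr.
Qed.

Definition concept_at (B x : nat) : atom := @mk_atom (concept_name B) [tuple x].
Definition label_at (l : label) (x : nat) : atom := concept_at (label_name l) x.
(** The variables are pairwise distinct, as simplicity requires; an assignment may still identify
    them, so every [R]-fact is an instance. *)
Definition generic_atom (R : nat * nat) : atom := @mk_atom R [tuple of iota 0 (arity R)].

(* A label [(T, b)] on a constant says that the guessed homomorphism to the template [T]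
   sends it to [b]. The tautologies [RuleIDB] keep the labels out of the EDB schema even
   when the data schema is empty. *)
Variant template_rule : seq atom * seq atom -> Prop :=
  | RuleIDB l of l \in labels :
      template_rule ([:: label_at l 0], [:: label_at l 0])
  | RuleGuess R i of R \in S & i \in iota 0 (arity R) :
      template_rule ([seq label_at l i | l <- labels], [:: generic_atom R])
  | RuleSame l l' of l \in labels & l' \in labels & l.1 != l'.1 :
      template_rule ([::], [:: label_at l 0; label_at l' 1])
  | RuleHom T f of T \in Ts & f \in facts_on S T.1 & f \notin T.2 :
      template_rule ([::], generic_atom (tag f) ::
        [seq label_at (T, nth 0 (tagged f) i) i | i <- iota 0 (arity (tag f))])
  | RuleGoal l of l \in labels & concept_fact A l.2 \in l.1.2 :
      template_rule ([:: concept_at goal_name 0], [:: label_at l 0]).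

Definition template_specs : seq (seq atom * seq atom) :=
  [seq ([:: label_at l 0], [:: label_at l 0]) | l <- labels] ++
  [seq ([seq label_at l i | l <- labels], [:: generic_atom R]) | R <- S, i <- iota 0 (arity R)] ++
  [seq ([::], [:: label_at l 0; label_at l' 1])
    | l <- labels, l' <- [seq l' : label <- labels | l.1 != l'.1]] ++
  [seq ([::], generic_atom (tag f) ::
        [seq label_at (T, nth 0 (tagged f) i) i | i <- iota 0 (arity (tag f))])
    | T : template <- Ts, f : fact <- [seq f : fact <- facts_on S T.1 | f \notin T.2]] ++
  [seq ([:: concept_at goal_name 0], [:: label_at l 0])
    | l <- [seq l : label <- labels | concept_fact A l.2 \in l.1.2]].

Lemma template_specsP s : s \in template_specs <-> template_rule s.
Proof.
rewrite /template_specs 4!mem_cat; split=> [|[]].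
- case/or4P=> [/mapP [l ? ->]|/allpairsPdep [R [i [? ? ->]]]|/allpairsPdep [l [l' [? + ->]]]|].
  + by constructor.
  + by constructor.
  + by rewrite mem_filter => /andP [? ?]; constructor.
  case/orP=> [/allpairsPdep [T [f [? + ->]]]|/mapP [l + ->]].
    by rewrite mem_filter => /andP [? ?]; constructor.
  by rewrite mem_filter => /andP [? ?]; constructor.
- by move=> l lL; rewrite (map_f (fun l => ([:: label_at l 0], [:: label_at l 0]))).
- move=> R i RS iR; apply/or4P/Or42/allpairsPdep; by exists R, i.
- move=> l l' lL lL' ll'; apply/or4P/Or43/allpairsPdep; exists l, l'.
  by rewrite mem_filter ll'.
- move=> T f TT fT Nf; apply/or4P/Or44/orP; left; apply/allpairsPdep; exists T, f.
  by rewrite mem_filter Nf.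
- move=> l lL lA; apply/or4P/Or44/orP; right; apply/mapP; exists l => //.
  by rewrite mem_filter lA.
Qed.

Lemma nth_labels T f i : T \in Ts -> f \in facts_on S T.1 -> i \in iota 0 (arity (tag f)) ->
  (T, nth 0 (tagged f) i) \in labels.
Proof.
move=> TT; rewrite mem_facts_on mem_iota /= add0n => /andP [_ /allP fT] i_lt.
by rewrite mem_labels TT; apply: fT; apply: mem_nth; rewrite size_tuple.
Qed.

Lemma template_rule_wf s : template_rule s ->
  s.2 != [::] /\ {subset atoms_vars s.1 <= atoms_vars s.2}.
Proof.
case=> [l _|R i _ iR|l l' _ _ _|T f _ _ _|l _ _]; split=> // x.
by move=> /atoms_varsP [_ /mapP [l _ ->]]; rewrite inE => /eqP ->; rewrite /atoms_vars /= cats0.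
Qed.

Lemma template_rule_head s a : template_rule s -> a \in s.1 ->
  tag a = concept_name goal_name /\ size s.1 = 1 \/
  exists2 l, l \in labels & tag a = concept_name (label_name l).
Proof.
case=> //=.
- by move=> l lL; rewrite inE => /eqP ->; right; exists l.
- by move=> R i RS iR /mapP [l lL ->]; right; exists l.
- by move=> l lL lA; rewrite inE => /eqP ->; left.
Qed.

Lemma template_rule_body s a : template_rule s -> a \in s.2 ->
  tag a \in S \/ exists2 l, l \in labels & tag a = concept_name (label_name l).
Proof.
case=> /=.
- by move=> l lL; rewrite inE => /eqP ->; right; exists l.
- by move=> R i RS iR; rewrite inE => /eqP ->; left.
- by move=> l l' lL lL' _; rewrite !inE => /orP [] /eqP ->; right; [exists l|exists l'].
- move=> T f TT fT _; rewrite inE => /predU1P [->|/mapP [i i_lt ->]].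
    by left; move: fT; rewrite mem_facts_on => /andP [].
  by right; exists (T, nth 0 (tagged f) i) => //; apply: nth_labels.
- by move=> l lL lA; rewrite inE => /eqP ->; right; exists l.
Qed.

Lemma template_program : exists P : ddlog,
  [seq rule_spec r | r <- rules P] = template_specs /\ goal P = concept_name goal_name.
Proof.
have [|rs rsE] := @rules_of_specs template_specs.
  by move=> s /template_specsP/template_rule_wf.
have goal_body : all (fun r => ~~ occurs_in (concept_name goal_name) (body r)) rs.
  suff : all (fun s : _ * _ => ~~ occurs_in (concept_name goal_name) s.2) template_specs.
    by rewrite -rsE all_map.
  apply/allP => s /template_specsP sP; apply/hasPn => a /(template_rule_body sP) [].
    by apply: contraL => /eqP ->; apply: goal_fresh.
  by case=> l _ ->; apply/eqP => /(congr1 fst) /label_goal.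
have goal_head : all (fun r => occurs_in (concept_name goal_name) (Defs.head r) ==>
                               (size (Defs.head r) == 1)) rs.
  suff : all (fun s : _ * seq atom =>
      occurs_in (concept_name goal_name) s.1 ==> (size s.1 == 1)) template_specs.
    by rewrite -rsE all_map.
  apply/allP => s /template_specsP sP; apply/implyP => /hasP [a /(template_rule_head sP)].
  by case=> [[_ ->] //|[l _ ->] /eqP /(congr1 fst) /label_goal].
by exists (DDlog goal_body goal_head).
Qed.

(** * Correctness of the template program *)

Section Correctness.
Variable P : ddlog.
Hypothesis P_specs : [seq rule_spec r | r <- rules P] = template_specs.
Hypothesis P_goal : goal P = concept_name goal_name.

Lemma template_idb R : (R \in idb P) = has (fun s => R \in [seq tag a | a <- s.1]) template_specs.
Proof.
rewrite /idb in_fset.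
have -> : flatten [seq [seq tag a | a <- Defs.head r] | r <- rules P] =
          flatten [seq [seq tag a | a <- s.1] | s <- template_specs].
  by rewrite -P_specs -map_comp.
by apply/flatten_mapP/hasP.
Qed.

Lemma template_idb_sub R : R \in idb P ->
  R = concept_name goal_name \/ exists2 l, l \in labels & R = concept_name (label_name l).
Proof.
rewrite template_idb => /hasP [s /template_specsP sP /mapP [a /(template_rule_head sP) aE ->]].
by case: aE => [[-> _]|]; [left|right].
Qed.

Lemma label_idb l : l \in labels -> concept_name (label_name l) \in idb P.
Proof.
move=> lL; rewrite template_idb; apply/hasP; exists ([:: label_at l 0], [:: label_at l 0]).
  by apply/template_specsP; constructor.
by rewrite inE.
Qed.

(** Every symbol of [S] has positive arity and thus occurs in the body of a guessing rule, and
    freshness keeps it out of the heads. The only other body symbols are labels, which the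
    tautologies make IDB. *)
Lemma template_edb : edb P = S.
Proof.
apply/fsetP => R; rewrite /edb in_fsetD [X in _ && X]in_fset; apply/andP/idP => [[RI]|RS].
  have -> : flatten [seq [seq tag a | a <- body r] | r <- rules P] =
            flatten [seq [seq tag a | a <- s.2] | s <- template_specs].
    by rewrite -P_specs -map_comp.
  move=> /flatten_mapP [s /template_specsP sP /mapP [a /(template_rule_body sP) aE Ra]].
  by case: aE => [|[l lL aE]]; rewrite Ra //; move: RI; rewrite Ra aE label_idb.
split.
  apply/negP => /template_idb_sub; case=> [e|[l _ e]]; move: RS; rewrite e; apply/negP.
    exact: goal_fresh.
  exact: label_fresh.
have -> : flatten [seq [seq tag a | a <- body r] | r <- rules P] =
          flatten [seq [seq tag a | a <- s.2] | s <- template_specs].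
  by rewrite -P_specs -map_comp.
apply/flatten_mapP; exists ([seq label_at l 0 | l <- labels], [:: generic_atom R]).
  by apply/template_specsP; constructor; rewrite // mem_iota S_pos.
by rewrite inE.
Qed.

Lemma template_mddlog : mddlog P.
Proof.
by apply/allP => R /template_idb_sub; rewrite P_goal => -[->|[l _ ->]]; rewrite eqxx ?implybT.
Qed.

Lemma template_unary : unary_ddlog P.
Proof. by rewrite /unary_ddlog P_goal. Qed.

(** A rule has at most one atom over [S], a generic one; its other body atoms are labels, whose
    names are fresh. *)
Lemma template_simple : simple_ddlog P.
Proof.
rewrite /simple_ddlog template_edb.
suff : all (fun s : seq atom * seq atom => (count (fun a : atom => tag a \in S) s.2 <= 1)
    && all (fun a : atom => (tag a \in S) ==> uniq (tagged a)) s.2) template_specs.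
  by rewrite -P_specs all_map.
apply/allP => s /template_specsP [] /=.
- by move=> l _; rewrite (negPf (label_fresh _ _)).
- by move=> R i RS _; rewrite RS iota_uniq.
- by move=> l l' _ _ _; rewrite !(negPf (label_fresh _ _)).
- move=> T f _ _ _; rewrite iota_uniq implybT /= count_map all_map.
  rewrite (eq_count (a2 := pred0)); last by move=> i /=; apply/negbTE/label_fresh.
  rewrite count_pred0 addn0 leq_b1 /=; apply/allP => i _ /=.
  by rewrite (negPf (label_fresh _ _)).
- by move=> l _ _; rewrite (negPf (label_fresh _ _)).
Qed.

Lemma template_rules_hold S' (D' : instance S') :
  List.Forall (rule_holds D') (rules P) <->
  forall s, template_rule s -> forall nu : nat -> nat,
    all (fun a => ground nu a \in facts D') s.2 -> has (fun a => ground nu a \in facts D') s.1.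
Proof.
rewrite -(Forall_map rule_spec (fun s => forall nu : nat -> nat,
    all (fun a => ground nu a \in facts D') s.2 ->
    has (fun a => ground nu a \in facts D') s.1)) P_specs Forall_mem.
by split=> H s /template_specsP; apply: H.
Qed.

Lemma generic_var nu R i : i \in iota 0 (arity R) ->
  nu i \in (tagged (ground nu (generic_atom R)) : seq nat).
Proof. by move=> iR; apply: map_f. Qed.

Lemma data_schema (D : instance (edb P)) f : f \in facts D -> tag f \in S.
Proof. by move/factsP; rewrite {1}template_edb. Qed.

Section Model.
Variables (D : instance (edb P)) (T : template) (h : nat -> nat).
Hypothesis TT : T \in Ts.
Hypothesis hT : {in adom D, forall c, h c \in T.1}.
Hypothesis hD : {in facts D, forall f, fact_image h f \in T.2}.

Let adom_seq : seq nat := flatten [seq (tagged f : seq nat) | f : fact <- facts D].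

Let mem_adom_seq c : (c \in adom_seq) = (c \in adom D).
Proof. by apply/flatten_mapP/hasP. Qed.

(** The canonical model of a homomorphism [h]: each active constant carries the single label
    [(T, h c)], and [goal] holds exactly where the image satisfies [A]. *)
Let model : {fset fact} :=
  facts D `|` ([fset f in [seq concept_fact (label_name (T, h c)) c | c <- adom_seq]] `|`
    [fset f in [seq concept_fact goal_name c
                 | c <- [seq c <- adom_seq | concept_fact A (h c) \in T.2]]]).

Let modelP f : reflect
  [\/ f \in facts D,
      exists2 c, c \in adom D & f = concept_fact (label_name (T, h c)) c |
      exists2 c, c \in adom D & concept_fact A (h c) \in T.2 /\ f = concept_fact goal_name c]
  (f \in model).
Proof.
rewrite !in_fsetU ![_ \in [fset _ | _ in _]]in_fset; apply: (iffP or3P); case.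
- by move=> fD; apply: Or31.
- by case/mapP=> c; rewrite mem_adom_seq => cD ->; apply: Or32; exists c.
- case/mapP=> c; rewrite mem_filter mem_adom_seq => /andP [cA cD] ->.
  by apply: Or33; exists c.
- by move=> fD; apply: Or31.
- by case=> c cD ->; apply: Or32; apply/mapP; exists c; rewrite ?mem_adom_seq.
- case=> c cD [cA ->]; apply: Or33; apply/mapP; exists c => //.
  by rewrite mem_filter cA mem_adom_seq.
Qed.

Let model_label l c : concept_fact (label_name l) c \in model -> c \in adom D /\ l = (T, h c).
Proof.
case/modelP=> [/data_schema|[c' cD]|[c' cD [_]]].
- by rewrite (negPf (label_fresh _ _)).
- move=> e; have /(congr1 fst) /= e1 := congr1 tag e.
  have := congr1 (fun f : fact => tagged f : seq nat) e => /= -[->].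
  by split=> //; apply: label_name_inj.
- by move=> e; have /(congr1 fst) /= /label_goal := congr1 tag e.
Qed.

Let model_goal c : concept_fact goal_name c \in model -> concept_fact A (h c) \in T.2.
Proof.
case/modelP=> [/data_schema|[c' cD]|[c' cD [cA]]].
- by rewrite (negPf (goal_fresh _)).
- by move=> e; have /(congr1 fst) /= /esym /label_goal := congr1 tag e.
- by move=> e; have := congr1 (fun f : fact => tagged f : seq nat) e => /= -[->].
Qed.

Let model_data f : f \in model -> tag f \in S -> f \in facts D.
Proof.
case/modelP=> // [[c _ ->]|[c _ [_ ->]]] /=.
  by rewrite (negPf (label_fresh _ _)).
by rewrite (negPf (goal_fresh _)).
Qed.

(** The canonical model satisfies all rules, so it contains the answer, and its [goal] facts hold
    only at constants mapped into [A]. *)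
Lemma template_answer t : ddlog_answers D t ->
  {in (t : seq nat), forall a, concept_fact A (h a) \in T.2}.
Proof.
case=> tD /(_ (restriction _ model)) H a at_.
have : mk_fact t \in model.
  suff : mk_fact t \in facts (restriction (idb P `|` edb P) model).
    by rewrite restrictionE => /andP [].
  apply: H.
    apply/fsubsetP => f fD; rewrite restrictionE; apply/andP; split; first exact/modelP/Or31.
    by rewrite in_fsetU (factsP fD) orbT.
  apply/template_rules_hold => s sP nu b.
  have {}b : all (fun a => ground nu a \in model) s.2.
    by apply/allP => x /(allP b); rewrite restrictionE => /andP [].
  suff /hasP [x xs xm] : has (fun a => ground nu a \in model) s.1.
    apply/hasP; exists x => //; rewrite restrictionE xm in_fsetU template_idb /=.
    apply/orP; left; apply/hasP; exists s; first exact/template_specsP.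
    exact: (map_f (fun a : atom => tag a)).
  case: sP b => /=.
  - by move=> l _ /andP [->].
  - move=> R i RS iR /andP [Rm _].
    have nuD : nu i \in adom D.
      by apply: (facts_adom (model_data Rm RS)); apply: generic_var.
    apply/hasP; exists (label_at (T, h (nu i)) i).
      by apply: map_f; rewrite mem_labels TT hT.
    by rewrite ground_unary; apply/modelP/Or32; exists (nu i).
  - move=> l l' _ _ ll' /and3P []; rewrite !ground_unary.
    by case/model_label=> _ El /model_label [_ El']; move: ll'; rewrite El El' eqxx.
  - move=> T' f T'T fT' Nf /andP [fm]; rewrite all_map => /allP Hl.
    have fS : tag f \in S by move: fT'; rewrite mem_facts_on => /andP [].
    have {}Hl i : i \in iota 0 (arity (tag f)) -> T' = T /\ nth 0 (tagged f) i = h (nu i).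
      by move=> /Hl /=; rewrite ground_unary => /model_label [_ []].
    (* Positive arity supplies a first label, which identifies [T'] with [T]. *)
    have [T'E _] : T' = T /\ nth 0 (tagged f) 0 = h (nu 0).
      by apply: Hl; rewrite mem_iota S_pos.
    move/negP: Nf; case; rewrite T'E.
    (* A violated homomorphism rule would exhibit the forbidden fact [f] as the image of a data
       fact. *)
    have -> : f = fact_image h (ground nu (generic_atom (tag f))).
      apply: fact_eq => //; rewrite fact_image_vars ground_vars /= -map_comp.
      apply: (@eq_from_nth _ 0); first by rewrite size_map size_iota size_tuple.
      move=> i; rewrite size_tuple => i_lt.
      by rewrite (nth_map 0) ?size_iota // nth_iota // (Hl i _).2 // mem_iota.
    by apply: hD; apply: model_data fm fS.
  - move=> l _ lA /andP [+ _]; rewrite ground_unary => /model_label [cD lE].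
    rewrite orbF ground_unary; apply/modelP/Or33; exists (nu 0) => //.
    by move: lA; rewrite lE.
have -> : mk_fact t = concept_fact goal_name a.
  apply: fact_eq; first exact: P_goal.
  have := etrans (size_tuple t) (eqP template_unary); move: at_.
  rewrite -[a \in t]/(a \in tval t).
  by case: (tval t) => [|x [|]] //=; rewrite inE => /eqP ->.
exact: model_goal.
Qed.
End Model.

(** One direction evaluates the answer in the canonical model. For the other, a homomorphism is read
    off the labels in an arbitrary model of the program; the goal rule then derives the answer. *)
Lemma template_answerP (D : instance (edb P)) (t : (arity (goal P)).-tuple nat) :
  ddlog_answers D t <->
  {subset t <= adom D} /\
  forall T h, T \in Ts -> {in adom D, forall c, h c \in T.1} ->
    {in facts D, forall f, fact_image h f \in T.2} ->
    {in (t : seq nat), forall a, concept_fact A (h a) \in T.2}.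
Proof.
split=> [Ht|[tD H]].
  split=> [|T h TT hT hD]; first by case: Ht.
  exact: (template_answer TT hT hD Ht).
split=> // D' /fsubsetP DD' /template_rules_hold D'P.
have [a tE] : exists a, t = [:: a] :> seq nat.
  by have := etrans (size_tuple t) (eqP template_unary); case: (tval t) => [|x [|]] // _; exists x.
have aD : a \in adom D by apply: tD; rewrite -[_ \in t]/(_ \in tval t) tE inE.
(* A constant may carry several labels; the first one is selected, and the default is never reached
   on the active domain. *)
pose candidates c := [seq l <- labels | concept_fact (label_name l) c \in facts D'].
pose label_of c : label := nth ((fset0, fset0), 0) (candidates c) 0.
have label_ofP c : c \in adom D ->
    label_of c \in labels /\ concept_fact (label_name (label_of c)) c \in facts D'.
  case/hasP=> f fD cf.
  suff : label_of c \in candidates c by rewrite mem_filter => /andP [].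
  apply: mem_nth; rewrite size_filter -has_count.
  have i_lt : index c (tagged f) < size (tagged f) by rewrite index_mem.
  have fS : tag f \in S by rewrite (data_schema fD).
  have iR : index c (tagged f) \in iota 0 (arity (tag f)).
    by rewrite mem_iota /= add0n; move: i_lt; rewrite size_tuple.
  (* This assignment turns the generic atom into [f] itself. *)
  have := D'P _ (RuleGuess fS iR) (nth 0 (tagged f)).
  rewrite /= has_map andbT => /(_ _) /hasP [|l lL lc].
    suff -> : ground (nth 0 (tagged f)) (generic_atom (tag f)) = f by apply: DD'.
    apply: fact_eq => //; rewrite ground_vars /=.
    by rewrite map_nth_iota0 ?take_oversize ?size_tuple.
  apply/hasP; exists l => //; move: lc; rewrite /= ground_unary nth_index //.
(* The template is taken from the answer constant [a]; the rules excluding labels of different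
   templates make it common to all active constants, even those not connected to [a]. *)
pose T := (label_of a).1; pose h c := (label_of c).2.
have sameT c : c \in adom D -> label_of c = (T, h c).
  move=> cD; have [lc lcD] := label_ofP c cD; have [la laD] := label_ofP a aD.
  rewrite /h /T; suff -> : (label_of a).1 = (label_of c).1 by case: (label_of c).
  apply/eqP; apply: contraT => /(RuleSame la lc) /D'P.
  move=> /(_ (fun i => if i == 0 then a else c)) /=.
  by rewrite !ground_unary /= laD lcD => /(_ isT).
have hT c : c \in adom D -> T \in Ts /\ h c \in T.1.
  by move=> cD; have [+ _] := label_ofP c cD; rewrite sameT // mem_labels => /andP.
have hlab c : c \in adom D -> concept_fact (label_name (T, h c)) c \in facts D'.
  by move=> cD; have [_] := label_ofP c cD; rewrite sameT.
have [TT _] := hT a aD.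
have hD : {in facts D, forall f, fact_image h f \in T.2}.
  move=> f fD; apply: contraT => Nf.
  have fT : fact_image h f \in facts_on S T.1.
    rewrite mem_facts_on (data_schema fD) /= all_map.
    by apply/allP => c cf; case: (hT c) => //; apply: facts_adom fD c cf.
  have /= := D'P _ (RuleHom TT fT Nf) (nth 0 (tagged f)).
  move=> -> //; apply/andP; split.
    suff -> : ground (nth 0 (tagged f)) (generic_atom (tag f)) = f by apply: DD'.
    apply: fact_eq => //; rewrite ground_vars /=.
    by rewrite map_nth_iota0 ?take_oversize ?size_tuple.
  rewrite all_map; apply/allP => i; rewrite mem_iota /= add0n => i_lt.
  rewrite ground_unary (nth_map 0) ?size_tuple //.
  by apply: hlab; apply: facts_adom fD _ _; apply: mem_nth; rewrite size_tuple.
have aT : concept_fact A (h a) \in T.2.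
  by apply: (H T h) => // [c /hT []//|]; rewrite tE inE.
have aL : (T, h a) \in labels by rewrite mem_labels TT; case: (hT a aD).
have /= := D'P _ (@RuleGoal (T, h a) aL aT) (fun=> a).
rewrite !ground_unary hlab // orbF => /(_ isT).
suff -> : mk_fact t = concept_fact goal_name a by [].
by apply: fact_eq => //=; rewrite tE.
Qed.
End Correctness.
End TemplateProgram.

(** * Strong homomorphisms *)

Section StructureOn.
Variables (S : schema) (Y : {fset nat}) (Y0 : Y != fset0) (p : pred fact).

Let F : {fset fact} := [fset f in facts_on S Y | p f].

Lemma structure_facts_over : all (fun f : fact => tag f \in S) F.
Proof. by apply/allP => f; rewrite in_fset inE mem_facts_on => /andP [/andP []]. Qed.

Lemma structure_adom : {subset adom (Instance structure_facts_over) <= Y}.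
Proof.
move=> c /hasP [f]; rewrite in_fset inE mem_facts_on => /andP [/andP [_ /allP fY] _]; exact: fY.
Qed.

Definition structure_on : structure S := Structure Y0 structure_adom.

Lemma structure_onE f :
  (f \in facts structure_on) = [&& tag f \in S, all (mem Y) (tagged f) & p f].
Proof. by rewrite in_fset inE mem_facts_on andbA. Qed.
End StructureOn.

Fixpoint equality_free (phi : fo) : bool :=
  match phi with
  | FTrue | FFalse | FAtom _ => true
  | FEq _ _ => false
  | FNot p | FEx _ p | FAll _ p => equality_free p
  | FAnd p q | FOr p q | FImp p q => equality_free p && equality_free q
  end.

Lemma concept_fo_equality_free C x : equality_free (concept_fo C x).
Proof.
by elim: C x => //= [C IHC D IHD|C IHC D IHD|[R|] C IH|[R|] C IH] x; rewrite ?IHC ?IHD ?IH.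
Qed.

Lemma SHIU_equality_free phi : SHIU_sentence phi -> equality_free phi.
Proof. by case=> // _ [C D] /=; rewrite !concept_fo_equality_free. Qed.

Section StrongHomomorphism.
Variables (S1 S2 : schema) (M : structure S1) (N : structure S2) (h : nat -> nat).
Hypothesis h_dom : {in dom M, forall c, h c \in dom N}.
Hypothesis h_surj : {in dom N, forall d, exists2 c, c \in dom M & h c = d}.
Hypothesis h_facts : forall f : fact, all (mem (dom M)) (tagged f) ->
  (f \in facts M) = (fact_image h f \in facts N).

(** Surjectivity transfers quantifiers, and strongness makes atoms agree in both directions.
    Equations are excluded since [h] may identify elements. *)
Lemma sat_strong_hom phi nu nu' : equality_free phi ->
  (forall x, nu x \in dom M) -> (forall x, nu' x = h (nu x)) ->
  sat M nu phi <-> sat N nu' phi.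
Proof.
elim: phi nu nu' => [||a|x y|p IH|p IHp q IHq|p IHp q IHq|p IHp q IHq|x p IH|x p IH] nu nu' //=.
- move=> _ nuM nu'E; rewrite h_facts; last by rewrite all_map; apply/allP => i _ /=.
  suff -> : ground nu' a = fact_image h (ground nu a) by [].
  by apply: fact_eq => //=; rewrite -map_comp; apply: eq_map => i; apply: nu'E.
- by move=> pe nuM nu'E; rewrite (IH nu nu').
- by move=> /andP [pe qe] nuM nu'E; rewrite (IHp nu nu') // (IHq nu nu').
- by move=> /andP [pe qe] nuM nu'E; rewrite (IHp nu nu') // (IHq nu nu').
- by move=> /andP [pe qe] nuM nu'E; rewrite (IHp nu nu') // (IHq nu nu').
- move=> pe nuM nu'E.
  have E c : c \in dom M ->
      sat M [eta nu with x |-> c] p <-> sat N [eta nu' with x |-> h c] p.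
    by move=> cM; apply: IH => // y /=; case: eqP.
  split=> [[c cM]|[d /h_surj [c cM <-]]] pc; last by exists c => //; apply/E.
  by exists (h c); [apply: h_dom | apply/E].
- move=> pe nuM nu'E.
  have E c : c \in dom M ->
      sat M [eta nu with x |-> c] p <-> sat N [eta nu' with x |-> h c] p.
    by move=> cM; apply: IH => // y /=; case: eqP.
  split=> [H d /h_surj [c cM <-]|H c cM]; first by apply/E => //; apply: H.
  by apply/E => //; apply/H/h_dom.
Qed.

Lemma models_strong_hom O : List.Forall equality_free O -> models M O <-> models N O.
Proof.
rewrite !models_Forall !ForallP => eqf; split=> H phi phiO nu nuN.
  (* An assignment into [N] is lifted by choosing a preimage of each value. *)
  pose mu x := nth 0 [seq c <- dom M | h c == nu x] 0.
  have muP x : mu x \in dom M /\ nu x = h (mu x).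
    have [c cM hc] := h_surj (nuN x).
    have : mu x \in [seq c <- dom M | h c == nu x].
      apply: mem_nth; rewrite size_filter -has_count; apply/hasP; exists c => //.
      by rewrite hc.
    by rewrite mem_filter => /andP [/eqP -> ->].
  have E := @sat_strong_hom _ mu nu (eqf _ phiO) (fun x => (muP x).1) (fun x => (muP x).2).
  by apply/E; apply: H => // x; case: (muP x).
have E := @sat_strong_hom _ nu (h \o nu) (eqf _ phiO) nuN (fun x => erefl).
by apply/E; apply: H => // x; apply: h_dom.
Qed.
End StrongHomomorphism.

(** * Filtration *)

Lemma concept_comparable : comparable concept.
Proof. by rewrite /comparable /decidable; do 3? decide equality. Qed.

HB.instance Definition _ := hasDecEq.Build concept (compareP concept_comparable).

Definition children (C : concept) : seq concept :=
  match C with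
  | CName _ | CTop | CBot => [::]
  | CNot C | CAll _ C => [:: C]
  | CAnd C D | COr C D => [:: C; D]
  | CEx _ C => [:: C; CNot C]
  end.

Definition closed (base : seq concept) : Prop :=
  {in base, forall C, {subset children C <= base}}.

(* Negations are included because existential restrictions are transferred along edges as
   negated value restrictions. *)
Fixpoint closure (C : concept) : seq concept :=
  C :: CNot C ::
  match C with
  | CName _ | CTop | CBot => [::]
  | CNot C | CAll _ C | CEx _ C => closure C
  | CAnd C D | COr C D => closure C ++ closure D
  end.

Lemma mem_closure C : (C \in closure C) /\ (CNot C \in closure C).
Proof. by case: C => *; rewrite /= !inE !eqxx ?orbT. Qed.

Lemma closed_cat s1 s2 : closed s1 -> closed s2 -> closed (s1 ++ s2).
Proof.
move=> c1 c2 C; rewrite mem_cat => /orP [/c1|/c2] H D /H; rewrite mem_cat => ->;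
  by rewrite ?orbT.
Qed.

Lemma closed_closure C : closed (closure C).
Proof.
have step D s : closed s -> {subset children D <= s} -> closed (D :: CNot D :: s).
  move=> cs Ds E; rewrite !inE => /or3P [/eqP ->|/eqP ->|/cs H] X.
  - by move=> /Ds Xs; rewrite !inE Xs !orbT.
  - by rewrite /= inE => /eqP ->; rewrite !inE eqxx.
  - by move=> /H Xs; rewrite !inE Xs !orbT.
elim: C => [A|||C IH|C IHC D IHD|C IHC D IHD|r C IH|r C IH]; apply: step => //.
- by move=> X; rewrite inE => /eqP ->; case: (mem_closure C).
- exact: closed_cat.
- move=> X; rewrite !inE mem_cat => /orP [] /eqP ->; last rewrite orbC;
    by rewrite (mem_closure _).1.
- exact: closed_cat.
- move=> X; rewrite !inE mem_cat => /orP [] /eqP ->; last rewrite orbC;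
    by rewrite (mem_closure _).1.
- by move=> X; rewrite !inE => /orP [] /eqP ->; case: (mem_closure C).
- by move=> X; rewrite inE => /eqP ->; case: (mem_closure C).
Qed.

Lemma holds_transitivity (S : schema) (M : structure S) R :
  (forall nu, (forall x, nu x \in dom M) -> sat M nu (transitivity R)) <->
  forall c d e, c \in dom M -> d \in dom M -> e \in dom M ->
    role_fact R c d \in facts M -> role_fact R d e \in facts M -> role_fact R c e \in facts M.
Proof.
have /fset0Pn [c0 cM] := dom_neq0 M.
split=> [H c d e cX dX eX cd de|H nu _ c cX d dX e eX /=]; last first.
  by rewrite !ground_binary /= => -[]; apply: H.
have := H (fun=> c0) (fun=> cM) c cX d dX e eX.
by rewrite /= !ground_binary /=; apply.
Qed.

Lemma holds_role_inclusion (S : schema) (M : structure S) R R' :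
  (forall nu, (forall x, nu x \in dom M) -> sat M nu (role_inclusion R R')) <->
  forall c d, c \in dom M -> d \in dom M ->
    role_fact R c d \in facts M -> role_fact R' c d \in facts M.
Proof.
have /fset0Pn [c0 cM] := dom_neq0 M.
split=> [H c d cX dX cd|H nu _ c cX d dX /=]; last by rewrite !ground_binary; apply: H.
by have := H (fun=> c0) (fun=> cM) c cX d dX; rewrite /= !ground_binary /=; apply.
Qed.

Lemma holds_inverse_roles (S : schema) (M : structure S) R R' :
  (forall nu, (forall x, nu x \in dom M) -> sat M nu (inverse_roles R R')) <->
  forall c d, c \in dom M -> d \in dom M ->
    (role_fact R c d \in facts M) = (role_fact R' d c \in facts M).
Proof.
have /fset0Pn [c0 cM] := dom_neq0 M.
split=> [H c d cX dX|H nu _ c cX d dX /=]; last by rewrite !ground_binary /= H.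
have := H (fun=> c0) (fun=> cM) c cX d dX; rewrite /= !ground_binary /= => -[H1 H2].
by apply/idP/idP.
Qed.

Variant covered (base : seq concept) : fo -> Prop :=
  | CoveredInclusion C D of C \in base & D \in base : covered base (concept_inclusion C D)
  | CoveredTransitivity R : covered base (transitivity R)
  | CoveredRoleInclusion R R' : covered base (role_inclusion R R')
  | CoveredInverseRoles R R' : covered base (inverse_roles R R').

Lemma covered_sub base base' phi : {subset base <= base'} -> covered base phi -> covered base' phi.
Proof. by move=> sub [C D /sub Cb /sub Db|R|R R'|R R']; constructor. Qed.

Lemma SHIU_covered (O : seq fo) : List.Forall SHIU O ->
  exists2 base, closed base & List.Forall (covered base) O.
Proof.
elim=> [|phi {}O phiO _ [base bc bO]]; first by exists [::].
have [base' bc' bphi] : exists2 base', closed base' & covered base' phi.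
  case: phiO => [_ [C D]|R|R R'|R R']; last 3 first.
  - by exists [::] => //; constructor.
  - by exists [::] => //; constructor.
  - by exists [::] => //; constructor.
  exists (closure C ++ closure D); first by apply: closed_cat; apply: closed_closure.
  by constructor; rewrite mem_cat (mem_closure _).1 ?orbT.
exists (base' ++ base); first exact: closed_cat.
constructor; first by apply: covered_sub bphi => x; rewrite mem_cat => ->.
by apply: List.Forall_impl bO => psi; apply: covered_sub => x; rewrite mem_cat orbC => ->.
Qed.

Section Filtration.
Variables (S : schema) (M : structure S) (base : seq concept).
Hypothesis base_closed : closed base.

Let X := dom M.
Let F := facts M.

(* A role name together with a direction, [false] standing for the inverse. *)
Let drole : Type := (nat * bool)%type.

Definition droles : seq drole := [seq (R.1, b) | R <- S, b <- [:: true; false]].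

Lemma mem_droles R n b : (R, n) \in S -> (R, b) \in droles.
Proof. by move=> RS; apply/allpairsP; exists ((R, n), b); case: b. Qed.

Definition drole_rel (r : drole) (c d : nat) : bool :=
  if r.2 then role_fact r.1 c d \in F else role_fact r.1 d c \in F.

(** Inclusion, and likewise transitivity below, is read off [M] semantically, which accounts at once
    for everything the axioms entail about roles. *)
Definition drole_sub (r s : drole) : bool :=
  all (fun c => all (fun d => drole_rel r c d ==> drole_rel s c d) X) X.

Definition drole_trans (r : drole) : bool :=
  all (fun c => all (fun d => all (fun e =>
    drole_rel r c d ==> drole_rel r d e ==> drole_rel r c e) X) X) X.

Definition box (r : drole) (C : concept) (c : nat) : bool :=
  all (fun d => drole_rel r c d ==> concept_eval F X C d) X.

(* The value restrictions true at [c] that an [r]-edge from [c] to [d] transfers to [d]: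
   those along roles above [r], and those along a transitive role above [r] persist. *)
Definition flow (r : drole) (c d : nat) : bool :=
  all (fun s => all (fun C => drole_sub r s && box s C c ==> concept_eval F X C d &&
    all (fun q => [&& drole_trans q, drole_sub r q & drole_sub q s] ==> box q C d) droles)
    base) droles.

(** Both directions are required, so that passing to the converse of [R] just swaps the two
    conditions and inverse-role axioms can survive. *)
Definition edge (R c d : nat) : bool := flow (R, true) c d && flow (R, false) d c.

Lemma drole_subP r s : reflect
  (forall c d, c \in X -> d \in X -> drole_rel r c d -> drole_rel s c d) (drole_sub r s).
Proof.
apply: (iffP allP) => [H c d cX dX|H c cX].
  by have /allP /(_ d dX) /implyP := H c cX.
by apply/allP => d dX; apply/implyP; apply: H.
Qed.

Lemma drole_transP r : reflect
  (forall c d e, c \in X -> d \in X -> e \in X ->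
     drole_rel r c d -> drole_rel r d e -> drole_rel r c e) (drole_trans r).
Proof.
apply: (iffP allP) => [H c d e cX dX eX cd de|H c cX].
  by have /allP /(_ d dX) /allP /(_ e eX) := H c cX; rewrite cd de.
apply/allP => d dX; apply/allP => e eX; apply/implyP => cd; apply/implyP => de.
exact: H cd de.
Qed.

Lemma boxP r C c : reflect
  (forall d, d \in X -> drole_rel r c d -> concept_eval F X C d) (box r C c).
Proof.
by apply: (iffP allP) => H d dX; have := H d dX; [move/implyP | move=> {}H; apply/implyP].
Qed.

Lemma flowP r c d : reflect
  (forall s C, s \in droles -> C \in base -> drole_sub r s -> box s C c ->
     concept_eval F X C d /\
     forall q, q \in droles -> drole_trans q -> drole_sub r q -> drole_sub q s -> box q C d)
  (flow r c d).
Proof.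
apply: (iffP allP) => [H s C sD Cb rs sC|H s sD].
  have /allP /(_ C Cb) := H s sD; rewrite rs sC => /andP [Cd /allP Hq]; split=> // q qD qt rq qs.
  by have := Hq q qD; rewrite qt rq qs.
apply/allP => C Cb; apply/implyP => /andP [rs sC]; have [-> Hq] := H s C sD Cb rs sC.
by apply/allP => q qD; apply/implyP => /and3P []; apply: Hq.
Qed.

Lemma drole_sub_refl r : drole_sub r r.
Proof. by apply/drole_subP. Qed.

Lemma drole_sub_trans r s q : drole_sub r s -> drole_sub s q -> drole_sub r q.
Proof.
move=> /drole_subP rs /drole_subP sq; apply/drole_subP => c d cX dX cd.
by apply: sq => //; apply: rs.
Qed.

(** Along a transitive [q] between [r] and [s], every [q]-successor of [d] is already a
    [q]-successor of [c], hence an [s]-successor, where [C] holds. *)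
Lemma rel_flow r c d : c \in X -> d \in X -> drole_rel r c d -> flow r c d.
Proof.
move=> cX dX cd; apply/flowP => s C _ _ /drole_subP rs /boxP sC; split.
  by apply: sC => //; apply: rs.
move=> q _ /drole_transP qt /drole_subP rq /drole_subP qs; apply/boxP => e eX de.
apply: sC => //; apply: qs => //; apply: qt de => //; exact: rq.
Qed.

(** The larger role has fewer roles above it, so its flow imposes fewer conditions. *)
Lemma flow_mono r s c d : drole_sub r s -> flow r c d -> flow s c d.
Proof.
move=> rs /flowP H; apply/flowP => s' C s'D Cb ss' s'C.
have [Cd Hq] := H s' C s'D Cb (drole_sub_trans rs ss') s'C.
by split=> // q qD qt sq; apply: Hq => //; apply: drole_sub_trans rs sq.
Qed.

(** Taking [q] to be [r] in the first flow carries the restriction along [s] over to [d] as one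
    along [r], which the second flow delivers at [e]. A restriction along a transitive [q] above [r]
    passes through [d] in the same way. *)
Lemma flow_trans r c d e : r \in droles -> drole_trans r ->
  flow r c d -> flow r d e -> flow r c e.
Proof.
move=> rD rt /flowP cd /flowP de; apply/flowP => s C sD Cb rs sC.
have [_ H] := cd s C sD Cb rs sC; split.
  have [] // := de r C rD Cb (drole_sub_refl r).
  exact: H (drole_sub_refl r) rs.
move=> q qD qt rq qs; have [_] := de q C qD Cb rq (H q qD qt rq qs).
by apply=> //; apply: drole_sub_refl.
Qed.

(* Symbols that are neither unary nor binary occur in no axiom; they hold everywhere. *)
Definition saturated_fact (f : fact) : bool :=
  if arity (tag f) == 1 then f \in F
  else if arity (tag f) == 2 then edge (tag f).1 (nth 0 (tagged f) 0) (nth 0 (tagged f) 1)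
  else true.

Definition saturation : structure S := structure_on S (dom_neq0 M) saturated_fact.

Let F' := facts saturation.

Lemma saturation_concept A c : (concept_fact A c \in F') = (concept_fact A c \in F).
Proof.
rewrite structure_onE /=; apply/and3P/idP => [[] //|cF]; split=> //; first exact: factsP cF.
by rewrite andbT; apply: (facts_dom cF); rewrite inE.
Qed.

Lemma saturation_role R c d : (role_fact R c d \in F') =
  [&& role_name R \in S, c \in X, d \in X & edge R c d].
Proof. by rewrite structure_onE /= andbT -andbA. Qed.

Lemma facts_role R c d : role_fact R c d \in F -> [/\ role_name R \in S, c \in X & d \in X].
Proof.
move=> RF; split; first exact: factsP RF.
  by apply: (facts_dom RF); rewrite inE eqxx.
by apply: (facts_dom RF); rewrite !inE eqxx orbT.
Qed.

Lemma facts_edge R c d : role_fact R c d \in F -> edge R c d.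
Proof. by move=> RF; have [_ cX dX] := facts_role RF; rewrite /edge !rel_flow. Qed.

Lemma saturation_sub f : f \in F -> f \in F'.
Proof.
move=> fF; rewrite structure_onE (factsP fF) /=; apply/andP; split.
  exact/allP/(facts_dom fF).
rewrite /saturated_fact; case: eqP => // _; case: eqP => // E.
have [x [y [fxy fE]]] := binary_fact E.
by rewrite fxy /=; apply: facts_edge; rewrite -fE.
Qed.

(** Old edges survive, and new ones obey [flow], which preserves value restrictions. For an
    existential restriction: if [c] had no suitable successor in [M], then the negated filler would
    be a value restriction at [c] and would flow to the new successor. *)
Lemma saturation_eval C c : C \in base -> c \in X ->
  concept_eval F' X C c = concept_eval F X C c.
Proof.
elim: C c => [A|||C IH|C IHC D IHD|C IHC D IHD|r C IH|r C IH] c Cb cX //=.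
- exact: saturation_concept.
- by rewrite IH //; apply: (base_closed Cb); rewrite inE.
- by rewrite IHC ?IHD //; apply: (base_closed Cb); rewrite !inE eqxx ?orbT.
- by rewrite IHC ?IHD //; apply: (base_closed Cb); rewrite !inE eqxx ?orbT.
- have Cb' : C \in base by apply: (base_closed Cb); rewrite inE eqxx.
  have NCb : CNot C \in base by apply: (base_closed Cb); rewrite !inE eqxx orbT.
  case: r Cb => [R|] Cb /=; last by apply: eq_in_has => d dX /=; rewrite IH.
  apply/hasP/hasP => -[d dX /andP [Rcd Cd]]; last first.
    by exists d => //; rewrite saturation_sub // IH.
  move: Cd Rcd; rewrite IH // => Cd; rewrite saturation_role => /and4P [RS _ _ /andP [/flowP H _]].
  apply/hasP; apply: contraT => /hasPn N.
  have Nc : box (R, true) (CNot C) c.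
    by apply/boxP => e eX /= Rce; apply: contra (N e eX) => Ce; rewrite Ce andbT.
  by have [] := H _ _ (mem_droles true RS) NCb (drole_sub_refl _) Nc; rewrite /= Cd.
- have Cb' : C \in base by apply: (base_closed Cb); rewrite inE eqxx.
  case: r Cb => [R|] Cb /=; last by apply: eq_in_all => d dX /=; rewrite IH.
  apply/allP/allP => H d dX; apply/implyP => Rcd.
    by rewrite -IH //; apply: (implyP (H d dX)); apply: saturation_sub.
  rewrite IH //; move: Rcd; rewrite saturation_role => /and4P [RS _ _ /andP [/flowP Hf _]].
  have Cc : box (R, true) C c by apply/boxP => e eX; apply/implyP/H.
  by have [] := Hf _ _ (mem_droles true RS) Cb' (drole_sub_refl _) Cc.
Qed.

Lemma edge_mono R R' c d : drole_sub (R, true) (R', true) -> drole_sub (R, false) (R', false) ->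
  edge R c d -> edge R' c d.
Proof. by move=> s1 s2 /andP [H1 H2]; rewrite /edge (flow_mono s1) ?(flow_mono s2). Qed.

Lemma edge_converse R R' c d : drole_sub (R, true) (R', false) -> drole_sub (R, false) (R', true) ->
  edge R c d -> edge R' d c.
Proof. by move=> s1 s2 /andP [H1 H2]; rewrite /edge (flow_mono s2) ?(flow_mono s1). Qed.

(** Concept inclusions survive since evaluation on [base] is unchanged; role axioms become
    properties of directed roles, under which [flow] is monotone or transitive. *)
Lemma saturation_holds phi : covered base phi -> fo_sig phi `<=` S ->
  (forall nu, (forall x, nu x \in dom M) -> sat M nu phi) ->
  forall nu, (forall x, nu x \in dom saturation) -> sat saturation nu phi.
Proof.
case=> [C D Cb Db|R|R R'|R R'] sig.
- move=> /holds_inclusion H; apply/holds_inclusion => c cX.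
  by rewrite !saturation_eval //; apply: H.
- move=> /holds_transitivity H; apply/holds_transitivity => c d e cX dX eX.
  rewrite !saturation_role => /and4P [-> _ _ /andP [cd dc]] /and4P [_ _ _ /andP [de ed]].
  have RS b : (R, b) \in droles.
    apply: (@mem_droles _ 2); apply: (fsubsetP sig).
    by rewrite /= !in_fsetU in_fset1 eqxx.
  rewrite cX eX /=; apply/andP; split.
    by apply: flow_trans cd de => //; apply/drole_transP.
  (* Transitivity of [R] passes to its converse. *)
  apply: flow_trans ed dc => //; apply/drole_transP => x y z xX yX zX /= xy yz.
  exact: H yz xy.
- move=> /holds_role_inclusion H; apply/holds_role_inclusion => c d cX dX.
  rewrite !saturation_role => /and4P [_ _ _ cd]; rewrite cX dX /=; apply/andP; split.
    by apply: (fsubsetP sig); rewrite /= in_fsetU !in_fset1 eqxx orbT.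
  apply: edge_mono cd; apply/drole_subP => x y xX yX /=; exact: H.
- move=> /holds_inverse_roles H; apply/holds_inverse_roles => c d cX dX.
  have [RS RS'] : role_name R \in S /\ role_name R' \in S.
    by split; apply: (fsubsetP sig); rewrite /= !in_fsetU !in_fset1 !eqxx ?orbT.
  rewrite !saturation_role RS RS' cX dX /=; apply/idP/idP; apply: edge_converse;
    by apply/drole_subP => x y xX yX; rewrite /drole_rel /= ?(H x y xX yX) ?(H y x yX xX).
Qed.

Lemma saturation_models (O : seq fo) : List.Forall (covered base) O -> ont_sig O `<=` S ->
  models M O -> models saturation O.
Proof.
rewrite !models_Forall; elim: O => [|phi O IH] /=; first by constructor.
rewrite /ont_sig big_cons fsubUset => cO /andP [phiS OS] MO.
by inversion cO; inversion MO; constructor; [apply: saturation_holds | apply: IH].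
Qed.

(** The data on which [flow] and the unary facts depend, as a bit vector; points with equal bits are
    interchangeable in the saturation. *)
Definition code_bits (c : nat) : seq bool :=
  [seq concept_eval F X C c | C <- base] ++
  [seq box p.1 p.2 c | p <- [seq (r, C) | r <- droles, C <- base]] ++
  [seq concept_fact R.1 c \in F | R <- S].

Lemma code_bitsP c d : code_bits c = code_bits d ->
  [/\ {in base, forall C, concept_eval F X C c = concept_eval F X C d},
      forall r C, r \in droles -> C \in base -> box r C c = box r C d &
      forall A n, (A, n) \in S -> (concept_fact A c \in F) = (concept_fact A d \in F)].
Proof.
move/eqP; rewrite !eqseq_cat ?size_map // => /and3P [].
move=> /eqP/eq_in_map e1 /eqP/eq_in_map e2 /eqP/eq_in_map e3.
split=> // [r C rD Cb|A n AS]; last exact: e3 AS.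
by apply: (e2 (r, C)); apply/allpairsP; exists (r, C).
Qed.

Lemma flow_code r c d c' d' : code_bits c = code_bits c' -> code_bits d = code_bits d' ->
  flow r c d -> flow r c' d'.
Proof.
move=> /code_bitsP [_ cB _] /code_bitsP [dC dB _] /flowP H; apply/flowP => s C sD Cb rs.
rewrite -cB // => /(H s C sD Cb rs) [Cd Hq]; rewrite -dC //; split=> // q qD qt rq qs.
by rewrite -dB //; apply: Hq.
Qed.

Lemma edge_code R c d c' d' : code_bits c = code_bits c' -> code_bits d = code_bits d' ->
  edge R c d = edge R c' d'.
Proof.
by move=> cc' dd'; apply/andP/andP => -[H1 H2]; split; (apply: flow_code H1 || apply: flow_code H2).
Qed.

(** Unary facts and edges depend only on the codes of their arguments, and saturated facts of other
    arities always hold. *)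
Lemma saturation_code k (f : fact) : {in X, forall c, k c \in X /\ code_bits (k c) = code_bits c} ->
  all (mem X) (tagged f) -> (fact_image k f \in F') = (f \in F').
Proof.
move=> kP fX; rewrite !structure_onE fX /=.
have -> : all (mem X) [seq k c | c <- tagged f].
  by rewrite all_map; apply/allP => c /(allP fX) /kP [].
rewrite /= /saturated_fact /=.
case: (boolP (tag f \in S)) => //= fS; case: eqP => [f1|_].
  have [c fc] := vars_unary f1.
  have cX : c \in X by have := fX; rewrite fc /= andbT.
  have fE : f = concept_fact (tag f).1 c.
    by apply: fact_eq => //=; move: f1; case: (tag f) => [a n]; rewrite /arity /= => ->.
  have [_ kc] := kP c cX; have [_ _ H] := code_bitsP kc.
  rewrite fE fact_image_concept /= (H _ 1) //.
  by move: fS; rewrite {1}fE.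
case: eqP => // f2.
have [x [y [fxy _]]] := binary_fact f2.
move: fX; rewrite fxy /= andbT => /andP [/kP [_ kx] /kP [_ ky]].
exact: edge_code.
Qed.

Definition code (c : nat) : nat := choice.pickle (code_bits c).

(** Depends on [S] and [base] but not on [M], whence a size bound uniform in the model. *)
Definition code_length : nat := size base + (size droles * size base + size S).

Lemma code_word c : code_bits c \in words [:: true; false] code_length.
Proof.
rewrite mem_words !size_cat !size_map size_allpairs eqxx /=.
by apply/allP => -[].
Qed.
End Filtration.

(** [B] is the quotient of the saturation by equality of codes. Its elements are codes, so they lie
    in a set [V] fixed before [M]; the code map is a surjective strong homomorphism from the
    saturation, so [B] satisfies the ontology. *)
Lemma filtration (S : schema) (O : seq fo) : List.Forall SHIU O -> ont_sig O `<=` S ->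
  exists V : {fset nat}, forall M : structure S, models M O ->
  exists (B : structure S) (h : nat -> nat),
  [/\ models B O, {subset dom B <= V}, {in dom M, forall c, h c \in dom B},
      {in facts M, forall f, fact_image h f \in facts B} &
      forall A c, c \in dom M -> concept_fact A (h c) \in facts B ->
        concept_fact A c \in facts M].
Proof.
move=> OSHIU Osig; have [base bc bO] := SHIU_covered OSHIU.
exists [fset i in [seq choice.pickle w | w <- words [:: true; false] (code_length S base)]].
move=> M MO; pose h := code M base; pose N := saturation M base.
pose Y : {fset nat} := [fset y in [seq h c | c <- dom M]].
have YP y : reflect (exists2 c, c \in dom M & h c = y) (y \in Y).
  by rewrite in_fset; apply: (iffP mapP) => -[c cM yE]; exists c.
have hY : {in dom M, forall c, h c \in Y} by move=> c cM; apply/YP; exists c.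
have Y0 : Y != fset0.
  by have /fset0Pn [c cM] := dom_neq0 M; apply/fset0Pn; exists (h c); apply: hY.
(* A section of the code map, choosing a representative of each class. *)
pose g y := nth 0 [seq c <- dom M | h c == y] 0.
have gP y : y \in Y -> g y \in dom M /\ h (g y) = y.
  case/YP=> c cM hc.
  have : g y \in [seq c <- dom M | h c == y].
    by apply: mem_nth; rewrite size_filter -has_count; apply/hasP; exists c; rewrite ?hc.
  by rewrite mem_filter => /andP [/eqP -> ->].
have ghP : {in dom M, forall c,
    g (h c) \in dom M /\ code_bits M base (g (h c)) = code_bits M base c}.
  move=> c /hY /gP [gM hg]; split=> //; exact: (pcan_inj choice.pickleK) hg.
pose B := structure_on S Y0 (fun f => fact_image g f \in facts N).
have hB (f : fact) : all (mem (dom N)) (tagged f) -> (f \in facts N) = (fact_image h f \in facts B).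
  move=> fM; rewrite -(saturation_code ghP fM) [RHS]structure_onE /=.
  have -> : fact_image g (fact_image h f) = fact_image (g \o h) f.
    by apply: fact_eq => //=; rewrite -map_comp.
  have -> : all (mem Y) [seq h c | c <- tagged f].
    by rewrite all_map; apply/allP => c /(allP fM) /hY.
  apply/idP/andP => [fN|[]//]; split=> //; apply: (factsP (fN : _ \in facts N)).
exists B, h; split.
- apply/(models_strong_hom _ _ hB).
  + exact: hY.
  + by move=> y /YP.
  + by apply: List.Forall_impl OSHIU => phi; apply: SHIU_equality_free.
  + exact: saturation_models.
- move=> _ /YP [c _ <-]; rewrite in_fset; apply: map_f; exact: code_word.
- exact: hY.
- move=> f fM; rewrite -hB; first exact: saturation_sub.
  by apply/allP; apply: facts_dom fM.
- move=> A c cM; rewrite -fact_image_concept -hB /= ?andbT //.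
  by rewrite saturation_concept.
Qed.

(** * Certain answers as homomorphism problems *)

(** Being a model is a proposition rather than a Boolean test, so the list of candidate templates is
    cut down with excluded middle. *)
Lemma filter_Prop (T : eqType) (P : T -> Prop) (s : seq T) :
  exists s' : seq T, forall x, x \in s' <-> x \in s /\ P x.
Proof.
elim: s => [|y s [s' IH]]; first by exists [::] => x; split=> [|[]].
case: (classic (P y)) => Py.
  exists (y :: s') => x; rewrite !inE; split=> [/predU1P [->|/IH [xs Px]]|[]].
  - by rewrite eqxx.
  - by rewrite xs orbT.
  by case/predU1P=> [-> _|xs Px]; rewrite ?eqxx // (iffRL (IH x)) ?orbT.
exists s' => x; rewrite inE IH; split=> [[-> Px]|[/predU1P [->|//]]]; last by [].
by rewrite orbT.
Qed.

Definition is_template (S : schema) (O : seq fo) (T : template) : Prop :=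
  exists2 B : structure S, models B O & T = (dom B, facts B).

Lemma finite_templates (S : schema) (O : seq fo) (V : {fset nat}) :
  exists Ts : seq template, forall T, T \in Ts <-> {subset T.1 <= V} /\ is_template S O T.
Proof.
have [Ts TsP] := filter_Prop (is_template S O)
  [seq (Y, G) | Y <- enum_fset (fpowerset V), G <- enum_fset (fpowerset (facts_on S V))].
exists Ts => T; rewrite TsP; split=> -[TV TT]; split=> //.
  case/allpairsP: TV => -[Y G] /= [+ _ ->] /=.
  by rewrite -[_ \in _]/(Y \in fpowerset V) fpowersetE => /fsubsetP.
case: TT TV => B _ -> /= BV; apply/allpairsP; exists (dom B, facts B); split=> //=.
  by rewrite -[_ \in _]/(dom B \in fpowerset V) fpowersetE; apply/fsubsetP.
rewrite -[_ \in _]/(facts B \in fpowerset (facts_on S V)) fpowersetE.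
apply/fsubsetP => f fB; rewrite mem_facts_on (factsP fB) /=.
by apply/allP => c /(facts_dom fB) /BV.
Qed.

(* The disjoint union of [D] and [B], with every symbol interpreted by the preimage under
   [h + id], maps onto [B] by a strong homomorphism, hence satisfies the same
   equality-free sentences as [B]. *)
Lemma extend_homomorphism (S S' : schema) (O : seq fo) (B : structure S') (D : instance S)
    (h : nat -> nat) :
  List.Forall equality_free O -> models B O -> S `<=` S' ->
  {in adom D, forall c, h c \in dom B} -> {in facts D, forall f, fact_image h f \in facts B} ->
  exists M : structure S', [/\ models M O, facts D `<=` facts M &
    {in adom D, forall c A, concept_fact A c \in facts M -> concept_fact A (h c) \in facts B}].
Proof.
move=> Oeq BO SS' hdom hD.
pose adom_seq := flatten [seq (tagged f : seq nat) | f : fact <- facts D].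
have adomP c : (c \in adom_seq) = (c \in adom D) by apply/flatten_mapP/hasP.
(* All active constants of [D] lie below [K], so [B] shifted by [K] is disjoint from them. *)
pose K := (\max_(c <- adom_seq) c).+1.
have adomK c : c \in adom D -> c < K.
  by rewrite -adomP => cD; exact: (leq_bigmax_seq (F := id) c).
(* [h] on the data part, the inverse shift on the copy of [B]; the copy makes the map onto. *)
pose k c := if c < K then h c else (c - K)%N.
have kD c : c \in adom D -> k c = h c by rewrite /k => /adomK ->.
have kB c : k (K + c)%N = c by rewrite /k ltnNge leq_addr addKn.
pose Y : {fset nat} := [fset c in adom_seq ++ [seq (K + b)%N | b <- dom B]].
have YP c : reflect (c \in adom D \/ exists2 b, b \in dom B & c = (K + b)%N) (c \in Y).
  rewrite in_fset mem_cat adomP; apply: (iffP orP) => -[H|H]; try by left.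
    by right; case/mapP: H => b bB ->; exists b.
  by right; apply/mapP; case: H => b bB ->; exists b.
have Y0 : Y != fset0.
  have /fset0Pn [b bB] := dom_neq0 B.
  by apply/fset0Pn; exists (K + b)%N; apply/YP; right; exists b.
pose M := structure_on S' Y0 (fun f => fact_image k f \in facts B).
have image_adom f : f \in facts D -> fact_image k f = fact_image h f.
  move=> fD; apply: fact_eq => //=; apply/eq_in_map => c cf.
  by apply: kD; apply: facts_adom fD c cf.
exists M; split.
- suff E : models M O <-> models B O by apply/E.
  apply: (models_strong_hom (h := k)) Oeq.
  + by move=> c /YP [cD|[b bB ->]]; [rewrite kD ?hdom | rewrite kB].
  + by move=> b bB; exists (K + b)%N; [apply/YP; right; exists b | apply: kB].
  + move=> f fY; rewrite structure_onE fY /=; apply/andP/idP => [[]//|fB].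
    by split=> //; apply: (factsP (fB : _ \in facts B)).
- apply/fsubsetP => f fD; rewrite structure_onE image_adom // hD // andbT.
  rewrite (fsubsetP SS') ?(factsP fD) //=.
  by apply/allP => c cf; apply/YP; left; apply: facts_adom fD c cf.
- move=> c cD A; rewrite structure_onE => /and3P [_ _].
  by rewrite fact_image_concept kD.
Qed.

(** The schema and the arity index dependent types, so their equations are eliminated here once; the
    hypothesis therefore compares instances and tuples only by their underlying facts and
    sequences. *)
Lemma unary_simple_mddlog_transport (S : schema) (n : nat) (P : ddlog) (q : query S n) :
  mddlog P -> unary_ddlog P -> simple_ddlog P -> edb P = S -> arity (goal P) = n ->
  (forall (D : instance (edb P)) (t : (arity (goal P)).-tuple nat) (D' : instance S)
      (t' : n.-tuple nat), facts D = facts D' -> t = t' :> seq nat ->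
    q D' t' <-> ddlog_answers D t) ->
  exists2 q' : query S n, unary_simple_mddlog q' & equivalent q q'.
Proof.
move=> Pm Pu Ps eS en; case: S / eS q => q; case: n / en q => q H.
by exists (ddlog_query P); [constructor | move=> D t; apply: H].
Qed.

Lemma AQ_inv (S : schema) (n : nat) (q : query S n) : AQ q ->
  exists A (e : arity A = n), [/\ A \in S, n = 1 &
    forall D (t : n.-tuple nat) (t' : (arity A).-tuple nat),
      t = t' :> seq nat -> q D t <-> mk_fact t' \in facts D].
Proof.
case=> S' A AS A1; exists A, erefl; split=> // D t t' tt'.
by have -> : t = t' by apply: val_inj.
Qed.

(** A constant is a certain answer iff every homomorphism from the data to a bounded model of the
    ontology sends it into [A], and this is what the template program computes. *)
Lemma shiu_le_mddlog :
  at_least_as_expressive (over_binary_schemas unary_simple_mddlog)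
    (over_binary_schemas (omq_language SHIU AQ)).
Proof.
move=> S n q [Sb Oq].
suff [q' q'U qq'] : exists2 q' : query S n, unary_simple_mddlog q' & equivalent q q'.
  by exists q'.
case: Oq Sb => {n q}S O n q /AQ_inv [A [An [AS n1 qE]]] Sb.
have S_pos : {in S, forall R, 0 < arity R}.
  by move=> R /(allP Sb) /orP [] /eqP ->.
have SS' : S `<=` S `|` ont_sig O by apply: fsubsetUl.
have O_sig : ont_sig O `<=` S `|` ont_sig O by apply: fsubsetUr.
have [V VP] := filtration (axioms_in O) O_sig.
have [Ts TsP] := finite_templates (S `|` ont_sig O) O V.
have [P [P_specs P_goal]] := @template_program S Ts A.1.
have A1 : arity A = 1 by rewrite An.
have AE : A = concept_name A.1 by move: A1; case: (A) => [a m]; rewrite /arity /= => ->.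
apply: (@unary_simple_mddlog_transport S n P).
- exact: template_mddlog P_specs P_goal.
- exact: template_unary P_goal.
- exact: template_simple P_specs.
- exact: template_edb P_specs.
- by rewrite P_goal n1.
move=> D t D' t' DD' tt'; rewrite (template_answerP S_pos P_specs P_goal).
have adomE c : (c \in adom D) = (c \in adom D') by rewrite !unfold_in /adom DD'.
have tE : {subset t <= adom D} <-> {subset t' <= adom D'}.
  have mt c : (c \in t) = (c \in t') by rewrite -[LHS]/(c \in tval t) tt'.
  by split=> H c; [rewrite -mt -adomE | rewrite mt adomE]; apply: H.
have answerE (M : structure (S `|` ont_sig O)) a : t' = [:: a] :> seq nat ->
    q M t' <-> concept_fact A.1 a \in facts M.
  move=> ta; have at_A : size t' == arity A by rewrite size_tuple An.
  rewrite (qE _ _ (Tuple at_A)) //.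
  suff -> : mk_fact (Tuple at_A) = concept_fact A.1 a by [].
  by apply: fact_eq; [exact: AE | exact: ta].
have [a ta] : exists a, t' = [:: a] :> seq nat.
  by have := etrans (size_tuple t') n1; case: (tval t') => [|x [|]] // _; exists x.
have at' : a \in t' by rewrite -[_ \in _]/(a \in tval t') ta inE.
rewrite /= /certain_answers; split=> [[tD' H]|[/tE tD' H]]; split=> //; first exact/tE.
  (* A homomorphism to a template extends the data to a model, where [a] satisfies [A] by certainty;
     hence so does its image. *)
  move=> T h /TsP [_ [B BO ->]] /= hdom hD b; rewrite tt' ta inE => /eqP ->.
  have hdom' : {in adom D', forall c, h c \in dom B} by move=> c; rewrite -adomE; apply: hdom.
  have hD' : {in facts D', forall f, fact_image h f \in facts B} by rewrite -DD'.
  have Oeq : List.Forall equality_free O.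
    by apply: List.Forall_impl (axioms_in O) => phi; apply: SHIU_equality_free.
  have [M [MO DM MB]] := extend_homomorphism Oeq BO SS' hdom' hD'.
  by apply: MB; [apply: tD' | apply/(answerE M a ta); apply: H].
(* Filtration maps the given model to a template and reflects unary facts back. *)
move=> M MO DM; have [B [h [BO BV hdom hM hA]]] := VP M MO.
have adomM : {subset adom D' <= dom M}.
  by move=> c /(adom_sub DM); apply: adom_dom.
apply/(answerE M a ta)/hA; first exact/adomM/tD'.
apply: (H (dom B, facts B) h).
- by apply/TsP; split=> //; exists B.
- by move=> c; rewrite adomE => /adomM/hdom.
- by move=> f; rewrite DD' => /(fsubsetP DM)/hM.
- by rewrite tt' ta inE.
Qed.

(** * Composition of the translations *)

Lemma at_least_as_expressive_trans Q1 Q2 Q3 :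
  at_least_as_expressive Q3 Q2 -> at_least_as_expressive Q2 Q1 -> at_least_as_expressive Q3 Q1.
Proof.
move=> H32 H21 S n q1 /H21 [q2 /H32 [q3 Q3q3 e23] e12].
by exists q3 => // D t; rewrite e12.
Qed.

Theorem theorem5 :
  same_expressive_power
    (over_binary_schemas (omq_language ALCU AQ))
    (over_binary_schemas unary_simple_mddlog) /\
  same_expressive_power
    (over_binary_schemas (omq_language SHIU AQ))
    (over_binary_schemas unary_simple_mddlog).
Proof.
split; split.
- exact: at_least_as_expressive_trans shiu_le_mddlog alcu_le_shiu.
- exact: mddlog_le_alcu.
- exact: shiu_le_mddlog.
- exact: at_least_as_expressive_trans alcu_le_shiu mddlog_le_alcu.
Qed.
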